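(* Let $\mathbb{K}$ be a field of characteristic zero, $\lambda$ a positive integer, and $d\in\mathbb{K}[x,y,z]$ an irreducible polynomial such that (a) there exist a positive integer $m$ and integers $n,k$ with $\sigma_x^m(d)=\sigma_y^n\sigma_z^k(d)$, and (b) there exist integers $n_1,k_1$ with $n_1>0$ and $\sigma_y^{n_1}(d)=\sigma_z^{k_1}(d)$. Let $$r=\sum_{i=1}^I\sum_{\ell=1}^{m_i}\frac{b_{i,\ell}}{c_i^\ell d^\lambda},$$ where $b_{i,\ell}\in\mathbb{K}[x,y,z]$ with $\deg_z(b_{i,\ell})<\deg_z(d)$, the $c_i\in\mathbb{K}[x,y]$ are pairwise distinct irreducible polynomials with $\deg_y(b_{i,\ell})<\deg_y(c_i)$, and for each $i$ there are no integers $n_i',k_i'$ with $n_i'>0$ and $\sigma_x^{n_i'}(c_i)=\sigma_y^{k_i'}(c_i)$. For each $\ell\ge1$ set $r_\ell=\sum_{i=1}^I\frac{b_{i,\ell}}{c_i^\ell d^\lambda}$, where $b_{i,\ell}:=0$ if $\ell>m_i$. Then $r$ has a telescoper if and only if $r_\ell$ is $(\sigma_y,\sigma_z)$-summable for every $\ell$.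
   Context: $\sigma_x,\sigma_y,\sigma_z$ are the shift automorphisms of $\mathbb{K}(x,y,z)$: $\sigma_x(f)=f(x+1,y,z)$, $\sigma_y(f)=f(x,y+1,z)$, $\sigma_z(f)=f(x,y,z+1)$. A rational function $g\in\mathbb{K}(x,y,z)$ is $(\sigma_y,\sigma_z)$-summable if $g=\sigma_y(u)-u+\sigma_z(v)-v$ for some $u,v\in\mathbb{K}(x,y,z)$. A telescoper for $f$ is a nonzero operator $L=\sum_i \ell_i S_x^i$ with $\ell_i\in\mathbb{K}(x)$ such that $L(f)=\sum_i\ell_i f(x+i,y,z)$ is $(\sigma_y,\sigma_z)$-summable. *)

(* Defs.v *)
From HB Require Import structures.
From mathcomp Require Import all_boot all_order all_algebra.
From mathcomp Require Import fraction generic_quotient.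
Set Implicit Arguments. Unset Strict Implicit. Unset Printing Implicit Defensive.
Import Order.TTheory GRing.Theory Num.Theory.
Local Open Scope ring_scope.
Local Open Scope quotient_scope.
Local Notation "x %:F" := (@FracField.tofrac _ x).

Section Defs.
Variable K : fieldType.

(* K[x] = {poly K}, K[x,y] = {poly {poly K}} (y outer),
   K[x,y,z] = {poly {poly {poly K}}} (z outermost). *)
Definition Px := {poly K}.
Definition Pxy := {poly {poly K}}.
Definition Pxyz := {poly {poly {poly K}}}.
Definition Fxyz := {fraction Pxyz}.
Definition Fx := {fraction Px}.

Definition shift1 (R : comNzRingType) (n : int) (p : {poly R}) : {poly R} :=
  p \Po ('X + (n%:~R)%:P).

Definition sxy_x (n : int) (p : Pxy) : Pxy := map_poly (shift1 n) p.
Definition sxy_y (n : int) (p : Pxy) : Pxy := shift1 n p.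

Definition sx (n : int) (p : Pxyz) : Pxyz := map_poly (map_poly (shift1 n)) p.
Definition sy (n : int) (p : Pxyz) : Pxyz := map_poly (shift1 n) p.
Definition sz (n : int) (p : Pxyz) : Pxyz := shift1 n p.

(* extension of a (injective ring) endomorphism of K[x,y,z] to K(x,y,z),
   computed on a representative numerator/denominator pair *)
Definition fracmap (f : Pxyz -> Pxyz) (u : Fxyz) : Fxyz :=
  let q := repr u in (f (\n_q))%:F / (f (\d_q))%:F.

Definition Fsx n := fracmap (sx n).
Definition Fsy n := fracmap (sy n).
Definition Fsz n := fracmap (sz n).

Definition polyF (p : Pxyz) : Fxyz := p%:F.
Definition polyxyF (p : Pxy) : Fxyz := (p%:P : Pxyz)%:F.
Definition fracxF (u : Fx) : Fxyz :=
  let q := repr u in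
  ((\n_q)%:P%:P : Pxyz)%:F / ((\d_q)%:P%:P : Pxyz)%:F.

Definition yz_summable (g : Fxyz) : Prop :=
  exists u v : Fxyz, g = Fsy 1 u - u + (Fsz 1 v - v).

Definition apply_op (N : nat) (l : 'I_N.+1 -> Fx) (f : Fxyz) : Fxyz :=
  \sum_(j < N.+1) fracxF (l j) * Fsx (Posz j) f.

Definition has_telescoper (f : Fxyz) : Prop :=
  exists (N : nat) (l : 'I_N.+1 -> Fx),
    (exists j, l j != 0) /\ yz_summable (apply_op l f).

Definition irreducible_elt (R : idomainType) (p : R) : Prop :=
  p != 0 /\ p \isn't a GRing.unit /\
  forall a b : R, p = a * b -> a \is a GRing.unit \/ b \is a GRing.unit.

Definition sizey (p : Pxyz) : nat := (\max_(j < size p) size (nth 0%R (p : seq _) j))%N.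

End Defs.

(* Main.v *)
(* Write F = K(x), E = F(y), V = E(z). Expanding a rational function into partial
   fractions in z over E, and then each coefficient into partial fractions in y over F,
   attaches to every pair e = (d', c') of irreducible polynomials of K[x,y,z] and K[x,y]
   an F-linear projection of V onto the fractions with denominator c'^l d'^lambda (for fixed
   exponents), and these projections are equivariant under the group Z^3 of shifts. If no
   shift with a nonzero x-part fixes c', then Z^3 acts freely on the orbit of e, so the sum
   phi_e of the projections over the (y,z)-orbit of e, transported back to e, is defined,
   vanishes on summable functions, and commutes with S_x up to moving e. Comparing leading
   terms along the orbit of e under S_x, a relation phi(L f) = 0 with L <> 0 forces
   phi_e(f) = 0. Finally f differs from the sum of its phi_e(f), over representatives e of
   the (y,z)-orbits, by a summable function; since l is part of the index, each r_l is
   treated separately. *)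
Require Import Defs.
From HB Require Import structures.
From mathcomp Require Import all_boot all_order all_algebra.
From mathcomp Require Import boolp classical_sets fsbigop.
From mathcomp Require Import fraction generic_quotient ring.
Set Implicit Arguments. Unset Strict Implicit. Unset Printing Implicit Defensive.
Import GRing.Theory.
Local Open Scope ring_scope.
Local Open Scope quotient_scope.
Local Notation tofrac := (@FracField.tofrac _).

(** * Gauss' lemma *)

Section Factorial.
Variable R : idomainType.
Implicit Types a b p : R.

(** Two notions of irreducibility meet here. The pairs e consist of polynomials over K, on which
    shifts act without denominators and where equality of translates can be tested; partial
    fractions need irreducibility over K(x)(y) and K(x), one variable at a time. Gauss' lemma
    bridges the two: an irreducible polynomial of positive degree stays irreducible, and two of them
    are either coprime over the field or associated by a unit. That unit is removed by fixing the
    leading coefficient, which shifts preserve. Equivariance of the projections comes from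
    uniqueness: a component is characterised by a shape that every shift carries to the same shape,
    so no explicit formula has to be commuted with shifts. The strict degree bounds on the b_{i,l}
    make every nonzero term of r a component of its own, invisible to the projections for any other
    pair or any other order of c. Hence the projections of r at order l are those of r_l, and the
    whole weight rests on showing that a telescoper for r forces every phi_e(r) to vanish. *)

Definition divides a b := exists c, b = a * c.

Definition prime_elt p :=
  [/\ p != 0, p \isn't a GRing.unit
    & forall a b, divides p (a * b) -> divides p a \/ divides p b].

(** Factors are prime rather than merely irreducible: a prime dividing a product divides one of its
    factors, so it can always be cancelled there, and uniqueness of factorisation is built in. *)
Definition factorial_domain :=
  forall a, a != 0 -> exists (u : R) (s : seq R),
    [/\ u \is a GRing.unit, forall p, p \in s -> prime_elt p & a = u * \prod_(p <- s) p].

Lemma prime_not_divides_unit p u : prime_elt p -> u \is a GRing.unit -> ~ divides p u.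
Proof. by case=> _ /negP pN _ uU [c uE]; apply: pN; move: uU; rewrite uE unitrM => /andP[]. Qed.

Lemma divides_prime q p : prime_elt q -> prime_elt p -> divides q p -> divides p q.
Proof.
move=> [q0 /negP qN qP] [p0 pN pP] [v pE].
have /pP[//|[t vE]] : divides p (q * v) by exists 1; rewrite mulr1.
case: qN; apply/unitrPr; exists t.
by apply: (mulfI p0); rewrite mulr1 mulrCA -vE.
Qed.
End Factorial.

Lemma factorial_field (K : fieldType) : factorial_domain K.
Proof. by move=> a a0; exists a, [::]; split=> //; rewrite ?unitfE // big_nil mulr1. Qed.

Section Content.
Variable R : idomainType.
Implicit Types (f g h : {poly R}) (p a : R).

Lemma size_sub_lead f : f != 0 ->
  (size (f - (lead_coef f)%:P * 'X^((size f).-1))%R < size f)%N.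
Proof.
move=> f0; have sf : (0 < size f)%N by rewrite size_poly_gt0.
rewrite -[X in (_ < X)%N](prednK sf) ltnS; apply/leq_sizeP => i.
rewrite leq_eqVlt => /predU1P[<-|lti].
  by rewrite coefB coefCM coefXn eqxx mulr1 lead_coefE subrr.
rewrite coefB coefCM coefXn gtn_eqF // mulr0 subr0.
by apply: nth_default; rewrite -(prednK sf).
Qed.

(** The leading coefficient of the product is the product of the leading coefficients, so [p]
    divides one of these. Subtracting the corresponding multiple of [p] removes a leading term and
    lowers the sum of the degrees. *)
Lemma prime_polyC p : prime_elt p -> prime_elt (p%:P : {poly R}).
Proof.
case=> p0 pN pP; split; first by rewrite polyC_eq0.
  by rewrite poly_unitE coefC eqxx negb_and pN orbT.
move=> f g; have [n] := ubnP (size f + size g).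
elim: n f g => // n IH f g; rewrite ltnS => len [h fgE].
have [->|f0] := eqVneq f 0; first by left; exists 0; rewrite mulr0.
have [->|g0] := eqVneq g 0; first by right; exists 0; rewrite mulr0.
have [] := pP (lead_coef f) (lead_coef g).
- by exists (lead_coef h); rewrite -lead_coefM fgE lead_coefM lead_coefC.
- case=> x xE; set q := x%:P * 'X^((size f).-1).
  have fE : f = (f - p%:P * q) + p%:P * q by rewrite subrK.
  have [||[y yE]|] := IH (f - p%:P * q) g; last by right.
  + apply: leq_trans len; rewrite ltn_add2r /q mulrA -polyCM -xE.
    exact: size_sub_lead.
  + by exists (h - q * g); rewrite mulrBl fgE mulrBr -mulrA.
  + by left; exists (y + q); rewrite mulrDr -yE -fE.
case=> x xE; set q := x%:P * 'X^((size g).-1).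
have gE : g = (g - p%:P * q) + p%:P * q by rewrite subrK.
have [|||[y yE]] := IH f (g - p%:P * q); last 2 first.
- by left.
- by right; exists (y + q); rewrite mulrDr -yE -gE.
- apply: leq_trans len; rewrite ltn_add2l /q mulrA -polyCM -xE.
  exact: size_sub_lead.
- by exists (h - f * q); rewrite mulrBr fgE mulrBr mulrCA.
Qed.

Definition primitive f := forall p, prime_elt p -> ~ divides p%:P f.

Lemma primitive_part f : factorial_domain R -> f != 0 ->
  exists (a : R) f0, [/\ a != 0, f = a%:P * f0 & primitive f0].
Proof.
move=> facR f0; have lf0 : lead_coef f != 0 by rewrite lead_coef_eq0.
have [u [s [uU sP leadE]]] := facR _ lf0.
(* The induction runs over the primes of the leading coefficient. The unit [u] is generalised to a
   cofactor [w] that no prime dividing [f] divides; it collects the primes already found not to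
   divide [f]. *)
have wP : forall p, prime_elt p -> divides p%:P f -> ~ divides p u.
  by move=> p pP _; apply: prime_not_divides_unit.
elim: s u {uU} f f0 {lf0} sP leadE wP => [|p s IH] w f f0 sP leadE wP.
  exists 1, f; split; rewrite ?mul1r ?oner_eq0 // => p pP pf; apply: (wP p pP pf).
  case: pf leadE => h ->; rewrite big_nil mulr1 lead_coefM lead_coefC => <-.
  by exists (lead_coef h).
have pP : prime_elt p by apply: sP; rewrite mem_head.
have sP' q : q \in s -> prime_elt q by move=> qs; apply: sP; rewrite inE qs orbT.
rewrite big_cons in leadE.
have [[f1 fE]|pNf] := pselect (divides p%:P f).
  have [|||q qP [h f1E]|a [g [a0 gE gP]]] := IH w f1 => //.
  - by apply: contraNneq f0 => f10; rewrite fE f10 mulr0.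
  - case: pP => p0 _ _; apply: (mulfI p0).
    by rewrite -[X in X * _]lead_coefC -lead_coefM -fE leadE mulrCA.
  - by apply: wP qP _; exists (p%:P * h); rewrite fE f1E mulrCA.
  - exists (p * a), g; split=> //; last by rewrite polyCM -mulrA -gE.
    by case: pP => p0 _ _; rewrite mulf_neq0.
apply: (IH (w * p)) => //; first by rewrite leadE mulrA.
move=> q qP qf; case: (qP) => _ _ qM /qM[]; first exact: wP.
move=> /(divides_prime qP pP) [c qE]; apply: pNf; case: qf => h ->.
by exists (c%:P * h); rewrite qE polyCM mulrA.
Qed.

Lemma primitive_irreducible f : irreducible_elt f -> (1 < size f)%N -> primitive f.
Proof.
move=> [f0 [fN fI]] sf p pP [h fE]; case: (fI _ _ fE).
  by case: (prime_polyC pP) => _ /negP.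
rewrite poly_unitE => /andP[/eqP sh _]; move: sf; rewrite fE size_Cmul ?sh //.
by case: pP.
Qed.

(** A factorisation of [f] over the fraction field becomes one of [a%:P * f] once denominators are
    cleared. Each prime of [a] stays prime among polynomials, so it can be taken out of [g] or [h];
    being constant, it leaves the degrees unchanged. *)
Lemma cancel_factor a f g h : factorial_domain R -> a != 0 -> a%:P * f = g * h ->
  exists g' h', [/\ f = g' * h', size g' = size g & size h' = size h].
Proof.
move=> facR a0; have [u [s [uU sP ->]]] := facR _ a0.
elim: s g h sP => [|p s IH] g h sP.
  rewrite big_nil mulr1 => fE; exists ((u^-1)%:P * g), h.
  rewrite -mulrA -fE mulrA -polyCM mulVr // mul1r size_Cmul //.
  by rewrite invr_eq0; apply: contraTneq uU => ->; rewrite unitr0.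
have pP : prime_elt p by apply: sP; rewrite mem_head.
have sP' q : q \in s -> prime_elt q by move=> qs; apply: sP; rewrite inE qs orbT.
have p0 : p != 0 by case: pP.
have [_ _ pM] := prime_polyC pP.
rewrite big_cons mulrCA polyCM -mulrA => fE.
have pp0 : p%:P != 0 :> {poly R} by rewrite polyC_eq0.
have [|[g1 gE]|[h1 hE]] := pM g h; first by rewrite -fE; eexists.
- have [|g' [h' [fE' sg sh]]] := IH g1 h sP'.
    by apply: (mulfI pp0); rewrite fE gE mulrA.
  by exists g', h'; split=> //; rewrite gE size_Cmul.
- have [|g' [h' [fE' sg sh]]] := IH g h1 sP'.
    by apply: (mulfI pp0); rewrite fE hE mulrCA.
  by exists g', h'; split=> //; rewrite hE size_Cmul.
Qed.

(** No prime of [a] divides the primitive [f], so all of them cancel from [h]. *)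
Lemma primitive_cancel a f g h : factorial_domain R -> a != 0 -> primitive f ->
  a%:P * g = f * h -> divides f g.
Proof.
move=> facR a0; have [u [s [uU sP ->]]] := facR _ a0 => fP.
elim: s h sP => [|p s IH] h sP.
  rewrite big_nil mulr1 => fE; exists ((u^-1)%:P * h).
  by rewrite mulrCA -fE mulrA -polyCM mulVr // mul1r.
have pP : prime_elt p by apply: sP; rewrite mem_head.
have sP' q : q \in s -> prime_elt q by move=> qs; apply: sP; rewrite inE qs orbT.
have [pp0 _ pM] := prime_polyC pP.
rewrite big_cons mulrCA polyCM -mulrA => fE.
have [|/(fP p pP)//|[h1 hE]] := pM f h; first by rewrite -fE; eexists.
by apply: (IH h1) => //; apply: (mulfI pp0); rewrite fE hE mulrCA.
Qed.

Variables (E : fieldType) (j : {rmorphism R -> E}).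
Hypothesis j_inj : injective j.
Hypothesis j_frac : forall e : E, exists a b, b != 0 /\ e = j a / j b.

Lemma j_neq0 a : (j a != 0) = (a != 0).
Proof. by rewrite -{1}(rmorph0 j) (inj_eq j_inj). Qed.

Lemma size_map_j f : size (map_poly j f) = size f.
Proof. exact: size_map_inj_poly (rmorph0 j) _. Qed.

Lemma clear_denominators (q : {poly E}) :
  exists a f, a != 0 /\ (j a)%:P * q = map_poly j f.
Proof.
elim/poly_ind: q => [|q c [a [f [a0 qE]]]].
  by exists 1, 0; rewrite oner_eq0 mulr0 rmorph0.
have [x [b [b0 cE]]] := j_frac c.
exists (b * a), (b%:P * f * 'X + (a * x)%:P); split; first by rewrite mulf_neq0.
have -> : map_poly j (b%:P * f * 'X + (a * x)%:P)
    = (j b)%:P * map_poly j f * 'X + (j a * j x)%:P.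
  by rewrite rmorphD /= map_polyC [map_poly _ (_ * _)]rmorphM /= map_polyX rmorphM /=
     map_polyC /= rmorphM.
rewrite -qE cE rmorphM /= mulrDr polyCM !mulrA; congr (_ + _); rewrite -!polyCM.
by rewrite [j b * j a]mulrC -mulrA [j b * _]mulrC divfK ?j_neq0.
Qed.

(** Only splittings into two factors of positive degree are excluded, since nonzero constants become
    units in [E]. This is exactly what is known of [g] in [factorial_poly_aux]. *)
Lemma irreducible_poly_of_split f : factorial_domain R -> (1 < size f)%N ->
    (forall g h, f = g * h -> (size g <= 1)%N \/ (size h <= 1)%N) ->
  irreducible_poly (map_poly j f).
Proof.
move=> facR sf fI; split; first by rewrite size_map_j.
move=> q sq /dvdpP[h fE].
have q0 : q != 0.
  by apply: contraTneq sf => q0; rewrite -size_map_j fE q0 mulr0 size_poly0.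
have h0 : h != 0.
  by apply: contraTneq sf => h0; rewrite -size_map_j fE h0 mul0r size_poly0.
have [a [g1 [a0 g1E]]] := clear_denominators q.
have [b [h1 [b0 h1E]]] := clear_denominators h.
have sg1 : size g1 = size q by rewrite -size_map_j -g1E size_Cmul ?j_neq0.
have sh1 : size h1 = size h by rewrite -size_map_j -h1E size_Cmul ?j_neq0.
have E1 : (a * b)%:P * f = g1 * h1.
  apply: (map_inj_poly j_inj (rmorph0 j)).
  rewrite !rmorphM /= !map_polyC /= fE -g1E -h1E.
  by rewrite -!mulrA; congr (_ * _); rewrite [RHS]mulrCA; congr (_ * _); rewrite mulrC.
have [|g2 [h2 [f2E sg2 sh2]]] := cancel_factor facR _ E1; first by rewrite mulf_neq0.
have sh : size h = 1%N.
  have [] := fI _ _ f2E; rewrite ?sg2 ?sh2 ?sg1 ?sh1 => s1.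
    by move: q0 sq; rewrite -size_poly_eq0; case: (size q) s1 => [|[]].
  by move: h0; rewrite -size_poly_eq0; case: (size h) s1 => [|[]].
have /size_poly1P[c c0 hE] : size h == 1%N by rewrite sh.
by rewrite fE hE mul_polyC eqp_sym eqp_scale.
Qed.

Lemma irreducible_poly_frac f : factorial_domain R -> irreducible_elt f -> (1 < size f)%N ->
  irreducible_poly (map_poly j f).
Proof.
move=> facR [f0 [fN fI]] sf; apply: irreducible_poly_of_split => // g h fE.
by case: (fI _ _ fE); rewrite poly_unitE => /andP[/eqP -> _]; [left | right].
Qed.

Lemma dvdp_map_divides f g : factorial_domain R -> primitive f ->
  map_poly j f %| map_poly j g -> divides f g.
Proof.
move=> facR fP /dvdpP[h gE]; have [a [h1 [a0 h1E]]] := clear_denominators h.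
apply: (primitive_cancel (h := h1) facR a0 fP).
apply: (map_inj_poly j_inj (rmorph0 j)).
by rewrite !rmorphM /= map_polyC /= gE -h1E [RHS]mulrCA; congr (_ * _); rewrite mulrC.
Qed.

Lemma factorial_poly_aux : factorial_domain R -> factorial_domain {poly R}.
Proof.
move=> facR f; have [n] := ubnP (size f); elim: n f => // n IH f; rewrite ltnS => sf f0.
have [a [g [a0 fE gP]]] := primitive_part facR f0.
have [u [s [uU sP aE]]] := facR _ a0.
have sfg : size g = size f by rewrite fE size_Cmul.
suff [v [t [vU tP gE]]] : exists (v : {poly R}) (t : seq {poly R}),
    [/\ v \is a GRing.unit, forall q : {poly R}, q \in t -> prime_elt q
      & g = v * \prod_(q <- t) q].
  exists (u%:P * v), ([seq p%:P | p <- s] ++ t); split.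
  - have u0 : u != 0 by apply: contraTneq uU => ->; rewrite unitr0.
    by rewrite unitrM vU andbT poly_unitE size_polyC u0 coefC eqxx uU.
  - move=> p; rewrite mem_cat => /orP[/mapP[q /sP qP ->]|/tP//].
    exact: prime_polyC.
  - rewrite fE aE gE big_cat /= big_map polyCM rmorph_prod /= -!mulrA.
    by congr (_ * _); rewrite mulrCA.
have g0 : g != 0 by rewrite -size_poly_eq0 sfg size_poly_eq0.
have [[g1 [g2 [gE s1 s2]]]|nsplit] :=
    pselect (exists g1 g2, [/\ g = g1 * g2, (1 < size g1)%N & (1 < size g2)%N]).
  have g10 : g1 != 0 by rewrite -size_poly_gt0 ltnW.
  have g20 : g2 != 0 by rewrite -size_poly_gt0 ltnW.
  have sg : size g = (size g1 + size g2).-1 by rewrite gE size_mul.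
  have [||v1 [t1 [v1U t1P g1E]]] := IH g1 => //.
    apply: leq_trans sf; rewrite -sfg sg; move: s1 s2.
    by case: (size g2) => [|[|k]] // _ _; rewrite !addnS /= -addSn ltnS leq_addr.
  have [||v2 [t2 [v2U t2P g2E]]] := IH g2 => //.
    apply: leq_trans sf; rewrite -sfg sg; move: s1 s2.
    by case: (size g1) => [|[|k]] // _ _; rewrite !addSn /= -addnS leq_addl.
  exists (v1 * v2), (t1 ++ t2); split; first by rewrite unitrM v1U.
    by move=> p; rewrite mem_cat => /orP[/t1P|/t2P].
  by rewrite gE g1E g2E big_cat /= mulrACA.
have [sg1|sg1] := leqP (size g) 1.
  (* A primitive constant is a unit, since any prime in its factorisation would divide it. *)
  exists g, [::]; split=> //; last by rewrite big_nil mulr1.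
  have sg : size g = 1%N by apply/eqP; rewrite eqn_leq sg1 size_poly_gt0.
  rewrite poly_unitE sg eqxx /=.
  have gC : g = (g`_0)%:P by apply: size1_polyC.
  have c0 : g`_0 != 0 by rewrite -polyC_eq0 -gC.
  have [w [r [wU rP cE]]] := facR _ c0.
  case: r rP cE => [|p r] rP cE; first by rewrite cE big_nil mulr1.
  case: (gP p); first by apply: rP; rewrite mem_head.
  by rewrite gC cE big_cons mulrCA polyCM; eexists.
exists 1, [:: g]; split; rewrite ?unitr1 //; last by rewrite big_seq1 mul1r.
move=> p; rewrite inE => /eqP ->; split=> //.
  by rewrite poly_unitE; case: eqP sg1 => // ->.
(* As [g] does not split, it is irreducible over [E], where irreducible polynomials are prime;
   primitivity brings divisibility back to [R]. *)
have gI : irreducible_poly (map_poly j g).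
  apply: irreducible_poly_of_split => // g1 g2 gE.
  have [|s1] := leqP (size g1) 1; first by left.
  have [|s2] := leqP (size g2) 1; first by right.
  by case: nsplit; exists g1, g2.
move=> x y [h xyE].
have [cop|ncop] := boolP (coprimep (map_poly j g) (map_poly j x)).
  right; apply: dvdp_map_divides => //; rewrite -(Gauss_dvdpr _ cop) -rmorphM /= xyE.
  by rewrite rmorphM dvdp_mulr.
left; apply: dvdp_map_divides => //.
have := gI.2 _ ncop (dvdp_gcdl _ _); rewrite /eqp => /andP[_ h1].
exact: dvdp_trans h1 (dvdp_gcdr _ _).
Qed.
End Content.

Lemma fraction_repr (R : idomainType) (u : {fraction R}) :
  u = tofrac (\n_(repr u)) / tofrac (\d_(repr u)).
Proof.
have d0 := denom_ratioP (repr u).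
apply: (canRL (mulfK _)); first by rewrite tofrac_eq0.
rewrite -{1}[u]reprK; move: (repr u) d0 => x d0.
rewrite -[\pi_(_) x]/(\pi_({fraction R}) x) !piE; apply/eqmodP => /=.
rewrite FracField.equivfE /FracField.mulf !numden_Ratio ?mulf_neq0 ?oner_eq0 //.
by rewrite !mulr1 mulrC.
Qed.

Lemma fraction_numden (R : idomainType) (u : {fraction R}) :
  exists a b : R, b != 0 /\ u = tofrac a / tofrac b.
Proof.
by exists (\n_(repr u)), (\d_(repr u)); split; [exact: denom_ratioP | exact: fraction_repr].
Qed.

Lemma tofrac_inj (R : idomainType) : injective (@FracField.tofrac R).
Proof. by move=> a b /eqP; rewrite tofrac_eq => /eqP. Qed.

Lemma factorial_poly (R : idomainType) : factorial_domain R -> factorial_domain {poly R}.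
Proof. exact: (factorial_poly_aux (@tofrac_inj R) (@fraction_numden R)). Qed.

(** By Gauss' lemma [p] is irreducible over [E], so a common factor makes it divide [q] there.
    Primitivity of [p] puts the quotient [t] into the polynomials over [R], where irreducibility of
    [q] makes it a unit. *)
Lemma coprime_or_associate (R : idomainType) (E : fieldType) (j : {rmorphism R -> E})
    (p q : {poly R}) : injective j ->
    (forall e : E, exists a b, b != 0 /\ e = j a / j b) ->
    factorial_domain R -> irreducible_elt p -> irreducible_elt q ->
    (1 < size p)%N -> (1 < size q)%N ->
  coprimep (map_poly j p) (map_poly j q) \/ exists2 t, t \is a GRing.unit & q = p * t.
Proof.
move=> j_inj j_frac facR pI qI sp sq.
have [cop|ncop] := boolP (coprimep (map_poly j p) (map_poly j q)); [by left|right].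
have pj := irreducible_poly_frac j_inj j_frac facR pI sp.
have [] := @dvdp_map_divides _ _ j j_inj j_frac p q facR.
- exact: primitive_irreducible.
- have := pj.2 _ ncop (dvdp_gcdl _ _); rewrite /eqp => /andP[_ h1].
  exact: dvdp_trans h1 (dvdp_gcdr _ _).
- move=> t qE; exists t => //; case: qI => _ [_ /(_ _ _ qE)[]] //.
  by case: pI => _ [/negP].
Qed.

(** * Partial fraction digits *)

Section FractionIdentities.
Variable L : fieldType.
Implicit Types P Q A R S X : L.

(** [k0], [n0], [n1] stand for powers of [P]; kept opaque, they spare [field] the symbolic
    exponents. The three identities serve linearity, uniqueness and existence of digits, in this
    order. *)
Lemma digits_add P X k0 n0 n1 A R S Q A' R' S' Q' :
    P != 0 -> k0 != 0 -> n0 != 0 -> n1 != 0 -> Q != 0 -> Q' != 0 ->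
  X * (A / (k0 * Q) + R / (P * k0) + S / (P * k0 * n0))
    + (A' / (k0 * Q') + R' / (P * k0) + S' / (P * k0 * n1))
  = (X * A * Q' + A' * Q) / (k0 * (Q * Q')) + (X * R + R') / (P * k0)
    + (X * S * n1 + S' * n0) / (P * k0 * (n0 * n1)).
Proof. by move=> p0 h1 h2 h3 h4 h5; field; rewrite p0 h1 h2 h3 h4 h5. Qed.

Lemma digits_clear P k0 n0 A R S Q : P != 0 -> k0 != 0 -> n0 != 0 -> Q != 0 ->
  (A / (k0 * Q) + R / (P * k0) + S / (P * k0 * n0)) * (k0 * Q * (P * n0))
  = A * (P * n0) + Q * (R * n0 + S).
Proof. by move=> p0 h1 h2 h3; field; rewrite p0 h1 h2 h3. Qed.

Lemma digits_split P k0 n0 Q A V B R S : P != 0 -> k0 != 0 -> n0 != 0 -> Q != 0 ->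
  (((B * P + R) * n0 + S) * Q + A * V * (P * k0 * n0)) / (P * k0 * n0 * Q)
  = (B * Q + A * V * k0) / (k0 * Q) + R / (P * k0) + S / (P * k0 * n0).
Proof. by move=> p0 h1 h2 h3; field; rewrite p0 h1 h2 h3. Qed.
End FractionIdentities.

Lemma tofrac_neq0 (R : idomainType) (a : R) : a != 0 -> tofrac a != 0.
Proof. by rewrite tofrac_eq0. Qed.

Section Digits.
Variable F : fieldType.
Implicit Types (p q r a b : {poly F}) (f g : {fraction {poly F}}) (k : nat).

(* [r] is the coefficient of [p ^- k.+1] in the [p]-adic expansion of [f]: the first summand
   carries the lower polar orders and the denominators prime to [p], the last one the higher
   polar orders. This shape is visibly linear in [f] and stable under ring automorphisms. *)
Definition isdig p k f r := (size r < size p)%N /\ exists (a q s : {poly F}) n,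
  [/\ coprimep q p, (size s < size (p ^+ n)%R)%N
    & f = tofrac a / (tofrac p ^+ k * tofrac q) + tofrac r / tofrac p ^+ k.+1
          + tofrac s / tofrac p ^+ (k.+1 + n)].

Lemma coprimep_neq0 p q : (1 < size p)%N -> coprimep q p -> q != 0.
Proof.
move=> sp; apply: contraTneq => ->; rewrite coprime0p -size_poly_eq1.
by case: eqP sp => // ->.
Qed.

Lemma size_mul_lt p q a b : (size p < size q)%N -> (size a <= size b)%N -> b != 0 ->
  (size (p * a)%R < size (q * b)%R)%N.
Proof.
move=> spq sab b0.
have q0 : q != 0 by rewrite -size_poly_gt0; case: (size q) spq.
have [->|p0] := eqVneq p 0; first by rewrite mul0r size_poly0 size_poly_gt0 mulf_neq0.
have [->|a0] := eqVneq a 0; first by rewrite mulr0 size_poly0 size_poly_gt0 mulf_neq0.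
rewrite !size_mul //; move: p0 a0 b0; rewrite -!size_poly_gt0 => p0 a0 b0.
rewrite prednK ?addn_gt0 ?p0 // -ltnS prednK ?addn_gt0 ?(leq_trans _ spq) //.
by rewrite -addSn leq_add.
Qed.

Lemma size_add_lt p q n : (size p < n)%N -> (size q < n)%N -> (size (p + q)%R < n)%N.
Proof. by move=> hp hq; apply: leq_ltn_trans (size_polyD _ _) _; rewrite gtn_max hp. Qed.

Lemma isdig_lin p k (c : F) f g r r' : (1 < size p)%N -> isdig p k f r -> isdig p k g r' ->
  isdig p k (tofrac c%:P * f + g) (c%:P * r + r').
Proof.
move=> sp [sr [a [q [s [n [cq ss ->]]]]]] [sr' [a' [q' [s' [n' [cq' ss' ->]]]]]].
have p0 : p != 0 by rewrite -size_poly_gt0 ltnW.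
have sc x : (size (c%:P * x)%R <= size x)%N by rewrite mul_polyC size_scale_leq.
split; first by apply: size_add_lt => //; apply: leq_ltn_trans sr.
exists (c%:P * a * q' + a' * q), (q * q'), (c%:P * s * p ^+ n' + s' * p ^+ n), (n + n')%N.
split; first by rewrite coprimepMl cq.
  apply: size_add_lt; rewrite exprD; last rewrite [p ^+ n * _]mulrC.
    by apply: size_mul_lt; rewrite ?expf_neq0 //; apply: leq_ltn_trans ss.
  by apply: size_mul_lt; rewrite ?expf_neq0.
rewrite !(rmorphD, rmorphM, rmorphXn) /= !exprD !exprS.
have := coprimep_neq0 sp cq; have := coprimep_neq0 sp cq'.
move=> /tofrac_neq0 q'0 /tofrac_neq0 q0; move/tofrac_neq0: p0 => p0.
by rewrite (digits_add (tofrac c%:P) _ _ _ _ _ _ p0 (expf_neq0 k p0) (expf_neq0 n p0)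
  (expf_neq0 n' p0) q0 q'0).
Qed.

(** After clearing denominators, [p ^+ n.+1] divides [q * (r * p ^+ n + s)], hence the second
    factor, whose degree is too small: it vanishes. As [s] has smaller degree than [p ^+ n], this
    leaves only [r = 0]. *)
Lemma isdig0 p k r : (1 < size p)%N -> isdig p k 0 r -> r = 0.
Proof.
move=> sp [sr [a [q [s [n [cq ss E]]]]]].
have p0 : p != 0 by rewrite -size_poly_gt0 ltnW.
have q0 := coprimep_neq0 sp cq.
have E1 : a * p ^+ n.+1 + q * (r * p ^+ n + s) = 0.
  move/tofrac_neq0: p0 => p0; move/tofrac_neq0: q0 => q0.
  have := digits_clear (tofrac a) (tofrac r) (tofrac s) p0 (expf_neq0 k p0) (expf_neq0 n p0) q0.
  rewrite -[_ * tofrac p ^+ k]exprS -exprD -E mul0r => /esym E1.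
  by apply/eqP; rewrite -tofrac_eq0 !(rmorphD, rmorphM, rmorphXn) /= exprS E1.
have E2 : r * p ^+ n + s = 0.
  apply: contraTeq (leqnn (size (p ^+ n.+1))) => nz; rewrite -ltnNge.
  have dv : p ^+ n.+1 %| r * p ^+ n + s.
    have cop : coprimep (p ^+ n.+1) q by rewrite coprimep_sym coprimep_expr.
    by rewrite -(Gauss_dvdpr _ cop) -(dvdp_addr _ (dvdp_mull a (dvdpp _))) E1 dvdp0.
  have := dvdp_leq nz dv; rewrite leqNgt => /negP[].
  apply: size_add_lt; rewrite exprS; first by apply: size_mul_lt; rewrite ?expf_neq0.
  apply: leq_trans ss _; rewrite size_mul ?expf_neq0 //.
  by case: (size p) sp => // m _; rewrite addSn leq_addl.
apply/eqP; move: E2; apply: contra_eqT => r0; rewrite addr_eq0; apply/eqP => E2.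
move: ss; rewrite -[s]opprK -E2 size_polyN size_mul ?expf_neq0 //.
by rewrite -size_poly_gt0 in r0; case: (size r) r0 => // m _; rewrite addSn /= ltnNge leq_addl.
Qed.

Lemma isdig_uniq p k f r r' : (1 < size p)%N -> isdig p k f r -> isdig p k f r' -> r = r'.
Proof.
move=> sp fr fr'; have := isdig_lin (- 1) sp fr fr'.
rewrite polyCN rmorphN /= rmorph1 !mulN1r addNr => /(isdig0 sp).
by move/eqP; rewrite addrC subr_eq0 => /eqP.
Qed.

Lemma isdig_coprime p k a q : coprimep q p -> (1 < size p)%N ->
  isdig p k (tofrac a / tofrac q) 0.
Proof.
move=> cq sp; have p0 : p != 0 by rewrite -size_poly_gt0 ltnW.
split; first by rewrite size_poly0 ltnW.
exists (a * p ^+ k), q, 0, 0%N; split=> //; first by rewrite size_poly0 expr0 size_poly1.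
rewrite !rmorph0 !mul0r !addr0 rmorphM rmorphXn /= [tofrac a * tofrac p ^+ k]mulrC.
rewrite -mulf_div divff ?mul1r //.
by rewrite expf_neq0 ?tofrac_neq0.
Qed.

(** The whole fraction fits into one summand of [isdig]: the last if k < k', the first if k' < k,
    the middle one if k = k'. *)
Lemma isdig_proper p k k' b : (1 < size p)%N -> (size b < size p)%N ->
  isdig p k (tofrac b / tofrac p ^+ k'.+1) (if k == k' then b else 0).
Proof.
move=> sp sb; have p0 : p != 0 by rewrite -size_poly_gt0 ltnW.
have p0' n : tofrac p ^+ n != 0 by rewrite expf_neq0 ?tofrac_eq0.
split; first by case: ifP; rewrite // size_poly0 ltnW.
case: (ltngtP k k') => [lt|lt|->].
- exists 0, 1, b, (k' - k)%N; rewrite coprime1p; split=> //; last first.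
    by rewrite !rmorph0 !mul0r !add0r addSn subnKC // ltnW.
  have : (0 < k' - k)%N by rewrite subn_gt0.
  case: (k' - k)%N => // m _; apply: leq_trans sb _; rewrite exprS size_mul ?expf_neq0 //.
  have : (0 < size (p ^+ m)%R)%N by rewrite size_poly_gt0 expf_neq0.
  by case: (size _) => // i _; rewrite addnS leq_addr.
- exists (b * p ^+ (k - k'.+1)), 1, 0, 0%N; rewrite coprime1p; split=> //.
    by rewrite size_poly0 expr0 size_poly1.
  rewrite !rmorph0 !mul0r !addr0 rmorph1 mulr1 rmorphM rmorphXn /=.
  by rewrite -{2}(subnKC lt) exprD invfM mulrA mulrAC mulrK // unitfE.
- exists 0, 1, 0, 0%N; rewrite coprime1p; split=> //.
    by rewrite size_poly0 expr0 size_poly1.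
  by rewrite !rmorph0 !mul0r !addr0 add0r.
Qed.

Lemma irreducible_coprime p q : irreducible_poly p -> ~~ (p %| q) -> coprimep q p.
Proof.
move=> pI; apply: contraR => nc; have := pI.2 _ nc (dvdp_gcdr _ _).
by rewrite /eqp => /andP[_ h]; apply: dvdp_trans h (dvdp_gcdl _ _).
Qed.

Lemma prime_power_part p b : irreducible_poly p -> b != 0 ->
  exists m q, coprimep q p /\ b = p ^+ m * q.
Proof.
move=> pI; have [n] := ubnP (size b); elim: n b => // n IH b; rewrite ltnS => sb b0.
have [/dvdpP[q bE]|] := boolP (p %| b); last first.
  by move=> h; exists 0%N, b; rewrite expr0 mul1r; split=> //; apply: irreducible_coprime.
have q0 : q != 0 by apply: contraNneq b0 => q0; rewrite bE q0 mul0r.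
have p0 : p != 0 by apply: contraNneq b0 => p0; rewrite bE p0 mulr0.
have [|//|m [q' [cq qE]]] := IH q.
  apply: leq_trans sb; rewrite bE size_mul //; move: pI.1 q0; rewrite -size_poly_gt0.
  case: (size p) => [|[|i]] // _; case: (size q) => // l _.
  by rewrite addnS /= addSn ltnS addnS ltnS leq_addr.
by exists m.+1, q'; split=> //; rewrite bE qE mulrC exprS mulrA.
Qed.

Lemma isdig_exists p k f : irreducible_poly p -> exists r, isdig p k f r.
Proof.
move=> pI; have sp := pI.1.
have p0 : p != 0 by rewrite -size_poly_gt0 ltnW.
have [a [b [b0 ->]]] := fraction_numden f.
have [m [q [cq bE]]] := prime_power_part pI b0.
have q0 := coprimep_neq0 sp cq.
have [lemk|ltkm] := leqP m k.
  exists 0; split; first by rewrite size_poly0 ltnW.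
  exists (a * p ^+ (k - m)), q, 0, 0%N; split=> //; first by rewrite size_poly0 expr0 size_poly1.
  rewrite bE -{2}(subnKC lemk) !(rmorph0, rmorphM, rmorphXn) /= !mul0r !addr0 exprD.
  rewrite [tofrac p ^+ m * tofrac p ^+ (k - m)]mulrC -[_ * tofrac q]mulrA.
  rewrite [tofrac a * tofrac p ^+ _]mulrC.
  by rewrite -mulf_div divff ?mul1r // expf_neq0 ?tofrac_neq0.
(* Bezout splits the fraction into a u / p^m + a v / q, the second part having denominator prime to
   [p]. Dividing a u by p^n with n = m - k - 1, and then the quotient by [p], isolates the base-[p]
   digit that ends up over p^(k+1). *)
have /Bezout_eq1_coprimepP [[u v] /= uvE] : coprimep q (p ^+ m) by rewrite coprimep_expr.
set R := a * u; set n := (m - k.+1)%N.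
set B := R %/ p ^+ n.
exists (B %% p); split; first by rewrite ltn_modp.
exists ((B %/ p) * q + a * v * p ^+ k), q, (R %% p ^+ n), n; split=> //.
  by rewrite ltn_modp expf_neq0.
have mE : m = (k.+1 + n)%N by rewrite subnKC.
have RE : a * u = (B %/ p * p + B %% p) * p ^+ n + R %% p ^+ n by rewrite -!divp_eq.
have aE : a = a * u * q + a * v * p ^+ m.
  by rewrite -!mulrA -mulrDr uvE mulr1.
rewrite {1}aE RE bE mE !exprD !exprS.
rewrite !(rmorphD, rmorphM, rmorphXn) /=.
move/tofrac_neq0: p0 => p0; move/tofrac_neq0: q0 => q0.
exact: (digits_split (tofrac a) (tofrac v) (tofrac (B %/ p)) (tofrac (B %% p))
  (tofrac (R %% p ^+ n)) p0 (expf_neq0 k p0) (expf_neq0 n p0) q0).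
Qed.

Section Map.
Variables (s : {rmorphism {poly F} -> {poly F}})
          (S : {rmorphism {fraction {poly F}} -> {fraction {poly F}}}).
Hypothesis size_s : forall p, size (s p) = size p.
Hypothesis S_tofrac : forall p, S (tofrac p) = tofrac (s p).

Lemma coprimep_rmorph p q : coprimep p q -> coprimep (s p) (s q).
Proof.
move=> /Bezout_eq1_coprimepP [[u v] /= uvE]; apply/Bezout_eq1_coprimepP.
by exists (s u, s v); rewrite /= -!rmorphM -rmorphD uvE rmorph1.
Qed.

Lemma isdig_map p k f r : isdig p k f r -> isdig (s p) k (S f) (s r).
Proof.
move=> [sr [a [q [t [n [cq st ->]]]]]]; split; first by rewrite !size_s.
exists (s a), (s q), (s t), n; split; first exact: coprimep_rmorph.
  by rewrite -rmorphXn !size_s.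
by rewrite !rmorphD !fmorph_div !rmorphM !rmorphXn !S_tofrac.
Qed.
End Map.

(** For irreducible [p] a digit exists and is unique, so the choice is determined and the default is
    never taken. *)
Definition dig p k f : {poly F} := xget 0 (isdig p k f).

Lemma digP p k f : irreducible_poly p -> isdig p k f (dig p k f).
Proof. by move=> pI; apply: xgetPex; apply: isdig_exists. Qed.

Lemma dig_eq p k f r : irreducible_poly p -> isdig p k f r -> dig p k f = r.
Proof. by move=> pI; apply: isdig_uniq (digP _ _ pI); apply: pI.1. Qed.

Lemma dig_lin p k (c : F) f g : irreducible_poly p ->
  dig p k (tofrac c%:P * f + g) = c%:P * dig p k f + dig p k g.
Proof. by move=> pI; apply: dig_eq => //; apply: isdig_lin pI.1 (digP _ _ _) (digP _ _ _). Qed.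

Lemma dig_coprime p k a q : irreducible_poly p -> coprimep q p ->
  dig p k (tofrac a / tofrac q) = 0.
Proof. by move=> pI cq; apply: dig_eq => //; apply: isdig_coprime pI.1. Qed.

Lemma dig_proper p k k' b : irreducible_poly p -> (size b < size p)%N ->
  dig p k (tofrac b / tofrac p ^+ k'.+1) = if k == k' then b else 0.
Proof. by move=> pI sb; apply: dig_eq => //; apply: isdig_proper pI.1 _. Qed.

Lemma dig_map (s : {rmorphism {poly F} -> {poly F}})
    (S : {rmorphism {fraction {poly F}} -> {fraction {poly F}}}) p k f :
    (forall p, size (s p) = size p) -> (forall p, S (tofrac p) = tofrac (s p)) ->
    irreducible_poly p -> irreducible_poly (s p) ->
  dig (s p) k (S f) = s (dig p k f).
Proof. by move=> sizeS SE pI spI; apply: dig_eq => //; apply: isdig_map => //; apply: digP. Qed.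

Lemma dig0 p k : irreducible_poly p -> dig p k 0 = 0.
Proof.
by move=> pI; rewrite -(mul0r (tofrac 1)^-1) -(rmorph0 tofrac) dig_coprime // coprime1p.
Qed.
End Digits.

(** * Torsion-freeness of graded modules *)

Lemma fsum_seq (J : choiceType) (M : zmodType) (Phi : J -> M) (s : seq J) :
  (forall i, Phi i != 0 -> i \in s) ->
  \sum_(i \in [set: J]%classic) Phi i = \sum_(i <- undup s) Phi i.
Proof.
move=> Ps; rewrite (fsbigE (undup s)) ?undup_uniq //; last first.
  by move=> i _; rewrite mem_undup => /negP iN; apply/eqP; apply: contra_notT iN; apply: Ps.
by apply: eq_bigl => i; rewrite in_setT.
Qed.

Section GradedTorsion.
Notation grp := (int * (int * int))%type.
Variables (F V : fieldType) (eta : {rmorphism F -> V}) (T : eqType) (good : T -> Prop).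
Variables (act : grp -> {rmorphism V -> V}) (tact : grp -> T -> T) (pr : T -> V -> V).
Hypothesis act_comp : forall g g' v, act g (act g' v) = act (g + g') v.
Hypothesis act0 : forall v, act 0 v = v.
Hypothesis tact_comp : forall g g' e, tact g (tact g' e) = tact (g + g') e.
Hypothesis tact0 : forall e, tact 0 e = e.
Hypothesis act_eta : forall h a, act (0, h) (eta a) = eta a.
Hypothesis good_tact : forall g e, good e -> good (tact g e).
Hypothesis tact_free : forall g e, good e -> tact g e = e -> g = 0.
Hypothesis pr_lin : forall e a u v, good e -> pr e (eta a * u + v) = eta a * pr e u + pr e v.
Hypothesis pr_act : forall g e v, good e -> pr (tact g e) (act g v) = act g (pr e v).
Hypothesis pr_supp : forall v, exists s : seq T, forall e, good e -> pr e v != 0 -> e \in s.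

Definition summable v := exists u w,
  v = act (0, (1, 0)) u - u + (act (0, (0, 1)) w - w).

(* For good [e] the support is finite (otherwise the sum would be the junk value 0). *)
Definition phi e v : V :=
  \sum_(h \in [set: int * int]%classic) act (0, - h) (pr (tact (0, h) e) v).

Lemma tact_inj e g g' : good e -> tact g e = tact g' e -> g = g'.
Proof.
move=> ge E; have := @tact_free (- g' + g) e ge.
rewrite -tact_comp E tact_comp addNr tact0 => /(_ erefl) E0.
by apply/eqP; rewrite -subr_eq0 addrC E0.
Qed.

(** By freeness each element of [s] is reached by at most one [h]. *)
Lemma finite_orbit_part e (s : seq T) : good e ->
  exists s' : seq (int * int), forall h, tact (0, h) e \in s -> h \in s'.
Proof.
move=> ge; elim: s => [|t s [s' IH]]; first by exists [::].
have [[h0 h0E]|N] := pselect (exists h, tact (0, h) e = t).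
  exists (h0 :: s') => h; rewrite !inE => /predU1P[E|/IH ->]; last by rewrite orbT.
  by move: E; rewrite -h0E => /(tact_inj ge)[->]; rewrite eqxx.
exists s' => h; rewrite inE => /predU1P[E|/IH//].
by case: N; exists h.
Qed.

Lemma phi_term_supp e v : good e -> exists s : seq (int * int),
  forall h, act (0, - h) (pr (tact (0, h) e) v) != 0 -> h \in s.
Proof.
move=> ge; have [s sP] := pr_supp v; have [s' s'P] := finite_orbit_part s ge.
exists s' => h; rewrite fmorph_eq0 => nz; apply: s'P; apply: sP nz.
exact: good_tact.
Qed.

Lemma phi_lin e a u v : good e -> phi e (eta a * u + v) = eta a * phi e u + phi e v.
Proof.
move=> ge; have [s1 s1P] := phi_term_supp u ge; have [s2 s2P] := phi_term_supp v ge.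
have [s3 s3P] := phi_term_supp (eta a * u + v) ge.
rewrite /phi !(@fsum_seq _ _ _ (s1 ++ s2 ++ s3)) /=; first last.
- by move=> h /s3P; rewrite !mem_cat => ->; rewrite !orbT.
- by move=> h /s1P; rewrite !mem_cat => ->.
- by move=> h /s2P; rewrite !mem_cat => ->; rewrite orbT.
rewrite mulr_sumr -big_split /=; apply: eq_bigr => h _.
by rewrite pr_lin ?rmorphD ?rmorphM /= ?act_eta //; apply: good_tact.
Qed.

Lemma phiD e u v : good e -> phi e (u + v) = phi e u + phi e v.
Proof. by move=> ge; have := phi_lin 1 u v ge; rewrite rmorph1 !mul1r. Qed.

Lemma phi0 e : good e -> phi e 0 = 0.
Proof. by move=> ge; apply: (addIr (phi e 0)); rewrite -phiD // !add0r. Qed.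

Lemma phiZ e a u : good e -> phi e (eta a * u) = eta a * phi e u.
Proof. by move=> ge; rewrite -[eta a * u]addr0 phi_lin // phi0 // addr0. Qed.

Lemma phiB e u v : good e -> phi e (u - v) = phi e u - phi e v.
Proof.
move=> ge; have := phi_lin (- 1) v u ge.
by rewrite rmorphN rmorph1 !mulN1r addrC [RHS]addrC.
Qed.

Lemma phi_sum e I (s : seq I) (P : pred I) (u : I -> V) : good e ->
  phi e (\sum_(i <- s | P i) u i) = \sum_(i <- s | P i) phi e (u i).
Proof. by move=> ge; apply: (big_morph (phi e)) => [x y|]; [apply: phiD | apply: phi0]. Qed.

(** A (y,z)-shift of [v] merely reindexes the orbit sum; this is why [phi] kills differences. *)
Lemma phi_act0 e h v : good e -> phi e (act (0, h) v) = phi e v.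
Proof.
move=> ge; rewrite /phi (reindex_fsbigT (fun x => x + h)) /=; last first.
  by exists (fun x => x - h) => x; rewrite ?addrK ?subrK.
apply: eq_fsbigr => x _; have -> : ((0, x + h) : grp) = (0, h) + (0, x).
  by congr pair => /=; rewrite ?addr0 // addrC.
rewrite -tact_comp pr_act; last exact: good_tact.
by rewrite act_comp; congr (act (_, _) _); rewrite /= ?addr0 // opprD subrK.
Qed.

(** Commutativity of the group lets any shift pass through the orbit sum, moving only the base
    point. *)
Lemma phi_act e g v : good e -> phi (tact g e) (act g v) = act g (phi e v).
Proof.
move=> ge; have [s sP] := phi_term_supp v ge.
have E h : act (0, - h) (pr (tact (0, h) (tact g e)) (act g v))
    = act g (act (0, - h) (pr (tact (0, h) e) v)).
  rewrite tact_comp addrC -tact_comp pr_act; last exact: good_tact.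
  by rewrite !act_comp addrC.
rewrite /phi !(@fsum_seq _ _ _ s) //; last by move=> h; rewrite E fmorph_eq0 => /sP.
by rewrite rmorph_sum; apply: eq_bigr.
Qed.

Lemma phi_summable e v : good e -> summable v -> phi e v = 0.
Proof.
move=> ge [u [w ->]]; rewrite phiD // !phiB // !phi_act0 //.
by rewrite !subrr addr0.
Qed.

(** By freeness an element of the finite support of [v] lies in the (y,z)-orbit of at most one
    x-translate of [e], so all far translates miss the support. *)
Lemma phi_eventually0 e v : good e ->
  exists B : nat, forall k, (B <= k)%N -> phi (tact (Posz k, 0) e) v = 0.
Proof.
move=> ge; have [s sP] := pr_supp v.
suff [B BP] : exists B : nat, forall k h, tact (Posz k, h) e \in s -> (k < B)%N.
  exists B => k Bk; rewrite /phi fsbig1 // => h _.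
  apply/eqP; rewrite fmorph_eq0; apply: contraLR Bk => nz; rewrite -ltnNge.
  apply: (BP k h); apply: sP; first exact: good_tact.
  by move: nz; rewrite tact_comp -[_ + _]/(0 + Posz k, h + 0) add0r addr0.
elim: {sP} s => [|t s [B IH]]; first by exists 0%N.
have [[k0 [h0 h0E]]|N] := pselect (exists k h, tact (Posz k, h) e = t).
  exists (maxn B k0.+1) => k h; rewrite !inE leq_max => /predU1P[E|/IH ->//].
  by move: E; rewrite -h0E => /(tact_inj ge)[->]; rewrite leqnn orbT.
exists B => k h; rewrite inE => /predU1P[E|/IH//].
by case: N; exists k, h.
Qed.

(** Let [J] be the order of the operator. [phi] at [tact (Posz J, 0) e] turns the summand of index i
    into a multiple of a shift of [phi (tact (Posz (J - i), 0) e) v]. If [phi] vanishes on [v] at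
    all proper forward translates of [e], only the summand [J] survives, and so [phi e v] vanishes
    too. *)
Lemma phi_torsion (N : nat) (l : 'I_N.+1 -> F) v : (exists i, l i != 0) ->
    summable (\sum_(i < N.+1) eta (l i) * act (Posz i, 0) v) ->
  forall e, good e -> phi e v = 0.
Proof.
move=> [i0 li0] Sv e ge; have [B] := phi_eventually0 v ge.
have [J lJ Jmax] := @arg_maxnP _ i0 (fun i => l i != 0) (fun i : 'I_N.+1 => nat_of_ord i) li0.
(* [B] bounds the forward translates at which [phi] may be nonzero. The induction keeps [e] general
   because it is applied to translates of [e], for which the bound is smaller. *)
elim: B e ge => [|B IH] e ge zero.
  by have := zero 0%N (leqnn _); rewrite -[(Posz 0, 0)]/(0 : grp) tact0.
have shift k : (0 < k)%N -> phi (tact (Posz k, 0) e) v = 0.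
  move=> k0; apply: IH; first exact: good_tact.
  move=> i Bi; rewrite tact_comp -[_ + _]/(Posz i + Posz k, 0 + 0) addr0 -PoszD.
  by apply: zero; rewrite -addn1 leq_add.
have geJ : good (tact (Posz J, 0) e) by apply: good_tact.
have := phi_summable geJ Sv; rewrite phi_sum // (bigD1 J) //= big1 ?addr0.
  rewrite phiZ // phi_act // => /eqP; rewrite mulf_eq0 !fmorph_eq0 (negPf lJ) /=.
  by move/eqP.
move=> i iJ; rewrite phiZ //; have [->|li] := eqVneq (l i) 0; first by rewrite rmorph0 mul0r.
have ltiJ : (i < J)%N by rewrite ltn_neqAle iJ /=; apply: Jmax.
have -> : tact (Posz J, 0) e = tact (Posz i, 0) (tact (Posz (J - i), 0) e).
  by rewrite tact_comp -[_ + _]/(Posz i + Posz (J - i), 0 + 0) addr0 -PoszD subnKC // ltnW.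
rewrite phi_act; last exact: good_tact.
by rewrite shift ?subn_gt0 // rmorph0 mulr0.
Qed.

Lemma summableD u v : summable u -> summable v -> summable (u + v).
Proof.
move=> [a [b ->]] [c [d ->]]; exists (a + c), (b + d); rewrite !rmorphD /=.
by rewrite !opprD addrACA; congr (_ + _); rewrite addrACA.
Qed.

Lemma summableN u : summable u -> summable (- u).
Proof. by move=> [a [b ->]]; exists (- a), (- b); rewrite !rmorphN /= !opprD. Qed.

Lemma summable0 : summable 0.
Proof. by exists 0, 0; rewrite !rmorph0 subrr addr0. Qed.

Lemma summable_sum I (s : seq I) (P : pred I) (u : I -> V) :
  (forall i, P i -> summable (u i)) -> summable (\sum_(i <- s | P i) u i).
Proof. by move=> Su; apply: big_ind => //; [exact: summable0 | exact: summableD]. Qed.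

(** Telescoping along 0, g, 2g, and so on. A negative multiple is handled by the positive one
    applied to the element shifted back, with the sign reversed. *)
Lemma summable_multiple (g : grp) (n : int) v :
  (forall u, summable (act g u - u)) -> summable (act (g *~ n) v - v).
Proof.
move=> Sg; have Sn (k : nat) u : summable (act (g *+ k) u - u).
  elim: k => [|k IH]; first by rewrite mulr0n act0 subrr; apply: summable0.
  rewrite -(subrK (act (g *+ k) u) (act _ u)) -addrA; apply: summableD => //.
  by rewrite mulrS -act_comp.
case: n => k; first exact: Sn.
have -> : g *~ Negz k = - (g *+ k.+1) by [].
rewrite -{2}(act0 v) -(subrr (g *+ k.+1)) -act_comp -opprB.
exact: summableN.
Qed.

Lemma summable_shift h v : summable (act (0, h) v - v).
Proof.
case: h => i j; have -> : ((0, (i, j)) : grp) = (0, (1, 0)) *~ i + (0, (0, 1)) *~ j.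
  have m0 (M : zmodType) n : (0 : M) *~ n = 0 by rewrite mul0rz.
  have E (M M' : zmodType) (x : M) (y : M') n : (x, y) *~ n = (x *~ n, y *~ n).
    case: n => n.
      by rewrite -!pmulrn; elim: n => [|n IH]; rewrite ?mulr0n // !mulrS IH.
    rewrite !NegzE !mulrNz -!pmulrn; elim: n => [|n IH]; rewrite ?mulr1n // ![_ *+ n.+2]mulrS.
    by rewrite !opprD IH.
  rewrite !E !m0 -![1 *~ _]/(_%:~R) !intz.
  by rewrite -[RHS]/(0 + 0, (i + 0, 0 + j)) !(addr0, add0r).
rewrite -act_comp; set w := act (_ *~ j) v.
rewrite -(subrK w (act _ w)) -addrA; apply: summableD; apply: summable_multiple => u.
  by exists u, 0; rewrite rmorph0 subrr addr0.
by exists 0, u; rewrite rmorph0 subrr add0r.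
Qed.

Definition concentrated e v :=
  pr e v = v /\ forall e', good e' -> e' <> e -> pr e' v = 0.

Lemma phi_concentrated e h v : good e -> concentrated (tact (0, h) e) v ->
  phi e v = act (0, - h) v.
Proof.
move=> ge [vE v0]; rewrite /phi (@fsum_seq _ _ _ [:: h]).
  by rewrite /= big_seq1 vE.
move=> h'; rewrite inE; apply: contraNT => neq; rewrite v0 ?rmorph0 //.
  exact: good_tact.
by move=> /(tact_inj ge)[/eqP]; rewrite (negPf neq).
Qed.

Lemma phi_concentrated0 e e' v : good e -> concentrated e' v ->
  (forall h, e' <> tact (0, h) e) -> phi e v = 0.
Proof.
move=> ge [_ v0] N; rewrite /phi fsbig1 // => h _; rewrite v0 ?rmorph0 //.
  exact: good_tact.
by move=> E; apply: (N h).
Qed.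

(** Within one (y,z)-orbit, components differ from their transports to a common representative by
    summable elements, and the transports add up to [phi] of the whole sum at that representative,
    which is zero. *)
Lemma summable_of_phi (I : finType) (P : pred I) (u : I -> V) (e : I -> T) :
    (forall i, P i -> good (e i) /\ concentrated (e i) (u i)) ->
    (forall i, P i -> phi (e i) (\sum_(i | P i) u i) = 0) ->
  summable (\sum_(i | P i) u i).
Proof.
move=> uP phi0.
pose R i k := `[< exists h, e i = tact (0, h) (e k) >].
have Rrefl i : R i i by apply/asboolP; exists 0; rewrite -[(0, 0)]/(0 : grp) tact0.
have Rsym i k : R i k -> R k i.
  move=> /asboolP[h E]; apply/asboolP; exists (- h).
  by rewrite E tact_comp -[_ + _]/(0 + 0, - h + h) addr0 addNr tact0.
have Rtrans i k m : R i k -> R k m -> R i m.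
  move=> /asboolP[h E] /asboolP[h' E']; apply/asboolP; exists (h + h').
  by rewrite E E' tact_comp -[_ + _]/(0 + 0, h + h') addr0.
(* [pick] depends only on the predicate, so indices in the same orbit receive the same
   representative. *)
pose rho i := odflt i [pick k | P k && R i k].
have rhoP i : P i -> P (rho i) /\ R i (rho i).
  move=> Pi; rewrite /rho; case: pickP => [k /andP[]//|/(_ i)].
  by rewrite Pi Rrefl.
have rho_eq i k : P i -> P k -> R i k -> rho i = rho k.
  move=> Pi Pk Rik; rewrite /rho (eq_pick (Q := fun m => P m && R k m)).
    by case: pickP => // /(_ k); rewrite Pk Rrefl.
  move=> m; congr (_ && _); apply/idP/idP; first exact: Rtrans (Rsym _ _ Rik).
  exact: Rtrans.
have same i k : P i -> rho i = rho k -> P k -> R i k.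
  move=> Pi E Pk; apply: Rtrans (rhoP i Pi).2 _; rewrite E.
  by apply: Rsym; apply: (rhoP k Pk).2.
have phiE i : P i -> exists h, phi (e (rho i)) (u i) = act (0, h) (u i).
  move=> Pi; have /asboolP[h hE] := (rhoP i Pi).2.
  exists (- h); apply: phi_concentrated; first by case: (uP _ (rhoP i Pi).1).
  by rewrite -hE; case: (uP i Pi).
have -> : \sum_(i | P i) u i =
    \sum_(i | P i) (u i - phi (e (rho i)) (u i)) + \sum_(i | P i) phi (e (rho i)) (u i).
  by rewrite -big_split /=; apply: eq_bigr => i _; rewrite subrK.
apply: summableD.
  apply: summable_sum => i /phiE[h ->]; rewrite -opprB; apply: summableN.
  exact: summable_shift.
rewrite (partition_big rho P) /=; last by move=> i /rhoP[].
apply: summable_sum => k Pk.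
have [[i [Pi ik]]|N] := pselect (exists i, P i /\ rho i = k); last first.
  rewrite big1 => [|i /andP[Pi /eqP ik]]; first exact: summable0.
  by case: N; exists i.
rewrite (_ : \sum_(_ | _) _ = 0); first exact: summable0.
(* Components from other orbits contribute nothing to [phi] at [e k], so the sum over this class is
   [phi] of the full sum. *)
rewrite -{2}(phi0 k Pk) phi_sum; last by case: (uP k Pk).
rewrite big_mkcondr; apply: eq_bigr => m Pm.
case: eqP => [->//|neq]; symmetry.
have [gk _] := uP k Pk; have [gm cm] := uP m Pm.
apply: phi_concentrated0 gk cm _ => h E; apply: neq; rewrite -ik.
apply: rho_eq => //; apply: Rtrans (_ : R m k) _; first by apply/asboolP; exists h.
by apply: Rsym; rewrite -ik; apply: (rhoP i Pi).2.
Qed.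
End GradedTorsion.

(** * Separation of the pole orders along the c_i *)

Section GradedDecoupling.
Notation grp := (int * (int * int))%type.
Variables (F V : fieldType) (eta : {rmorphism F -> V}) (T : eqType) (good : T -> Prop).
Variables (act : grp -> {rmorphism V -> V}) (tact : grp -> T -> T) (pr : nat -> T -> V -> V).
Hypothesis act_comp : forall g g' v, act g (act g' v) = act (g + g') v.
Hypothesis act0 : forall v, act 0 v = v.
Hypothesis tact_comp : forall g g' e, tact g (tact g' e) = tact (g + g') e.
Hypothesis tact0 : forall e, tact 0 e = e.
Hypothesis act_eta : forall h a, act (0, h) (eta a) = eta a.
Hypothesis good_tact : forall g e, good e -> good (tact g e).
Hypothesis tact_free : forall g e, good e -> tact g e = e -> g = 0.
Hypothesis pr_lin : forall l e a u v, good e ->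
  pr l e (eta a * u + v) = eta a * pr l e u + pr l e v.
Hypothesis pr_act : forall l g e v, good e -> pr l (tact g e) (act g v) = act g (pr l e v).
Hypothesis pr_supp : forall l v, exists s : seq T,
  forall e, good e -> pr l e v != 0 -> e \in s.
Variables (I : finType) (m : I -> nat) (u : I -> nat -> V) (e : I -> T).
(** [pr l'] picks out the exponent l' + 1, whence the shift of index. Zero terms form a separate
    case, because for them nothing guarantees that [e i] is good. *)
Hypothesis uP : forall i l, (1 <= l <= m i)%N -> u i l = 0 \/ good (e i) /\
  forall l' e', good e' -> pr l' e' (u i l) = if (e' == e i) && (l'.+1 == l) then u i l else 0.

Let r := \sum_i \sum_(1 <= l < (m i).+1) u i l.
Let rl l := \sum_(i | (l <= m i)%N) u i l.

Lemma sum_orders : r = \sum_(1 <= l < (\max_i m i).+1) rl l.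
Proof.
rewrite /r /rl [RHS](exchange_big_dep predT) //=; apply: eq_bigr => i _.
rewrite [RHS](big_cat_nat (n := (m i).+1)) //=; last by rewrite ltnS leq_bigmax.
rewrite -[LHS]addr0; congr (_ + _); last first.
  by rewrite big_nat_cond big_pred0 // => l; case: leqP; rewrite ?andbF.
rewrite [RHS]big_mkcond big_nat_cond [RHS]big_nat_cond; apply: eq_bigr => l.
by rewrite andbT ltnS => /andP[_ ->].
Qed.

(** Forward, torsion-freeness makes every projection sum vanish on [r]; each one sees only the terms
    of its own order, so it vanishes on [rl] at that order as well. Backward, [r] is a finite sum of
    the [rl l], so the operator 1 is a telescoper. *)
Theorem telescoper_decoupling :
  (exists (N : nat) (l : 'I_N.+1 -> F), (exists j, l j != 0) /\
     summable act (\sum_(j < N.+1) eta (l j) * act (Posz j, 0) r))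
  <-> forall l, (1 <= l)%N -> summable act (rl l).
Proof.
split=> [[N [c [cnz Sr]]] [//|l] _|Srl]; last first.
  exists 0%N, (fun=> 1); split; first by exists ord0; rewrite oner_neq0.
  rewrite big_ord_recl big_ord0 addr0 rmorph1 mul1r /= -[(Posz 0, 0)]/(0 : grp) act0 sum_orders.
  rewrite big_nat; apply: summable_sum => l /andP[l1 _]; exact: Srl.
have phi_r t (gt : good t) : phi act tact (pr l) t r = 0.
  exact: (phi_torsion act_comp tact_comp tact0 act_eta good_tact tact_free
           (pr_lin l) (pr_act l) (pr_supp l) cnz Sr gt).
have phi_sumE := phi_sum tact_comp tact0 act_eta good_tact tact_free (pr_lin l) (pr_supp l).
have phi_other t i l' : good t -> (1 <= l' <= m i)%N -> l' != l.+1 ->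
    phi act tact (pr l) t (u i l') = 0.
  move=> gt /uP[->|[_ prE] neq].
    by rewrite (phi0 tact_comp tact0 act_eta good_tact tact_free (pr_lin l) (pr_supp l) gt).
  rewrite /phi fsbig1 // => h _; rewrite prE; last exact: good_tact.
  by rewrite [l.+1 == _]eq_sym (negPf neq) andbF rmorph0.
have phi_rl t (gt : good t) : phi act tact (pr l) t (rl l.+1) = 0.
  rewrite -(phi_r t gt) /r /rl !phi_sumE // big_mkcond /=; apply: eq_bigr => i _.
  rewrite phi_sumE //; case: ifP => lm; last first.
    rewrite big_nat big1 // => l' l'm; apply: phi_other => //.
    by apply: contraFneq lm => <-; case/andP: l'm.
  rewrite (bigD1_seq l.+1) ?iota_uniq ?mem_index_iota //= big_nat_cond big1 ?addr0 //.
  by move=> l' /andP[l'm neq]; apply: phi_other.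
(* Vanishing terms are dropped first, since their [e i] may fail to be good. *)
have -> : rl l.+1 = \sum_(i | (l < m i)%N && (u i l.+1 != 0)) u i l.+1.
  by rewrite big_mkcondr; apply: eq_bigr => i _; case: eqP.
have conc i : (l < m i)%N && (u i l.+1 != 0) ->
    good (e i) /\ concentrated good (pr l) (e i) (u i l.+1).
  move=> /andP[lm nz]; have [z|[ge prE]] := @uP i l.+1 lm; first by rewrite z eqxx in nz.
  split=> //; split; first by rewrite prE // !eqxx.
  by move=> e' ge' /eqP neq; rewrite prE // (negPf neq).
apply: (summable_of_phi act_comp act0 tact_comp tact0 act_eta good_tact tact_free
  (pr_lin l) (pr_supp l) conc) => i Pi.
have [ge _] := conc i Pi; rewrite -[RHS](phi_rl (e i) ge); congr (phi _ _ _ _ _).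
by rewrite big_mkcondr; apply: eq_bigr => k _; case: eqP.
Qed.
End GradedDecoupling.

(** * Shifts of rational functions *)

Section FracLift.
Variables (R : idomainType) (L : fieldType) (f : {rmorphism R -> L}).
Hypothesis f_inj : injective f.

(** Injectivity keeps images of denominators nonzero; it is an argument so that the morphism
    structures below can be attached to the function. *)
Definition frac_lift of injective f := fun u : {fraction R} =>
  f (\n_(repr u)) / f (\d_(repr u)).
Local Notation lift := (frac_lift f_inj).

Lemma inj_rmorph_neq0 a : a != 0 -> f a != 0.
Proof. by apply: contraNneq => fa; apply/eqP/f_inj; rewrite fa rmorph0. Qed.

Lemma frac_lift_div a b : b != 0 -> lift (tofrac a / tofrac b) = f a / f b.
Proof.
move=> b0; set u := tofrac a / tofrac b; rewrite /frac_lift; have d0 := denom_ratioP (repr u).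
apply/eqP; rewrite eqr_div ?inj_rmorph_neq0 // -!rmorphM; apply/eqP; congr (f _).
apply: tofrac_inj; rewrite !rmorphM /=.
have := fraction_repr u; rewrite {1}/u => /eqP.
by rewrite eqr_div ?tofrac_neq0 // => /eqP ->; rewrite mulrC.
Qed.

Lemma frac_lift_tofrac a : lift (tofrac a) = f a.
Proof. by rewrite -[tofrac a]divr1 -(rmorph1 tofrac) frac_lift_div ?oner_neq0 // rmorph1 divr1. Qed.

Lemma frac_lift_zmod : zmod_morphism lift.
Proof.
move=> u v; have [a [b [b0 ->]]] := fraction_numden u.
have [c [d [d0 ->]]] := fraction_numden v.
rewrite -mulNr addf_div ?tofrac_neq0 // -rmorphN -!rmorphM -rmorphD.
rewrite !frac_lift_div ?mulf_neq0 // -mulNr addf_div ?inj_rmorph_neq0 //.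
by rewrite rmorphD !rmorphM rmorphN.
Qed.

Lemma frac_lift_monoid : monoid_morphism lift.
Proof.
split=> [|u v]; first by rewrite -(rmorph1 tofrac) frac_lift_tofrac rmorph1.
have [a [b [b0 ->]]] := fraction_numden u.
have [c [d [d0 ->]]] := fraction_numden v.
by rewrite mulf_div -!rmorphM !frac_lift_div ?mulf_neq0 // !rmorphM mulf_div.
Qed.

HB.instance Definition _ :=
  GRing.isZmodMorphism.Build {fraction R} L lift frac_lift_zmod.
HB.instance Definition _ :=
  GRing.isMonoidMorphism.Build {fraction R} L lift frac_lift_monoid.
End FracLift.

Section PolyShift.
Variables (R : comNzRingType) (s : {rmorphism R -> R}) (n : int).

(** Acting on the coefficients by [s] at the same time lets the shifts in x, y and z be built by
    iteration, one variable at a time. *)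
Definition pshift (p : {poly R}) : {poly R} := shift1 n (map_poly s p).

Lemma pshift_zmod : zmod_morphism pshift.
Proof. by move=> p q; rewrite /pshift /shift1 rmorphB comp_polyB. Qed.

Lemma pshift_monoid : monoid_morphism pshift.
Proof.
split=> [|p q]; first by rewrite /pshift /shift1 rmorph1 comp_polyC.
by rewrite /pshift /shift1 rmorphM comp_polyM.
Qed.

HB.instance Definition _ := GRing.isZmodMorphism.Build {poly R} {poly R} pshift pshift_zmod.
HB.instance Definition _ :=
  GRing.isMonoidMorphism.Build {poly R} {poly R} pshift pshift_monoid.

Lemma pshiftC c : pshift c%:P = (s c)%:P.
Proof. by rewrite /pshift /shift1 map_polyC comp_polyC. Qed.

Lemma pshiftX : pshift 'X = 'X + n%:~R%:P.
Proof. by rewrite /pshift /shift1 map_polyX comp_polyX. Qed.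
End PolyShift.

Lemma pshift_map (R R' : comNzRingType) (j : {rmorphism R -> R'}) (s : {rmorphism R -> R})
    (s' : {rmorphism R' -> R'}) n p : (forall x, j (s x) = s' (j x)) ->
  map_poly j (pshift s n p) = pshift s' n (map_poly j p).
Proof.
move=> jE; elim/poly_ind: p => [|p c IH]; first by rewrite !rmorph0.
rewrite !(rmorphD, rmorphM) /= !pshiftX !pshiftC map_polyX !map_polyC /= pshiftX pshiftC.
by rewrite rmorphD /= map_polyX map_polyC /= rmorph_int jE IH.
Qed.

Lemma pshift_comp (R : comNzRingType) (s1 s2 s3 : {rmorphism R -> R}) n1 n2 p :
  (forall x, s1 (s2 x) = s3 x) ->
  pshift s1 n1 (pshift s2 n2 p) = pshift s3 (n1 + n2) p.
Proof.
move=> sE; elim/poly_ind: p => [|p c IH]; first by rewrite !rmorph0.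
rewrite !(rmorphD, rmorphM) /= !pshiftX !pshiftC IH sE.
rewrite rmorphD /= pshiftX pshiftC (rmorph_int s1).
by rewrite intrD polyCD addrA.
Qed.

Lemma pshift_id (R : comNzRingType) (s : {rmorphism R -> R}) p :
  (forall x, s x = x) -> pshift s 0 p = p.
Proof.
move=> sE; elim/poly_ind: p => [|p c IH]; first by rewrite !rmorph0.
by rewrite !(rmorphD, rmorphM) /= !pshiftX !pshiftC IH sE addr0.
Qed.

Section PolyShiftDomain.
Variables (R : idomainType) (s : {rmorphism R -> R}) (n : int).
Hypothesis s_inj : injective s.

Lemma size_pshift p : size (pshift s n p) = size p.
Proof.
rewrite /pshift /shift1 size_comp_poly2 ?size_map_inj_poly ?rmorph0 //.
exact: size_XaddC.
Qed.

Lemma lead_coef_pshift p : lead_coef (pshift s n p) = s (lead_coef p).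
Proof.
rewrite /pshift /shift1 lead_coef_comp ?size_XaddC //.
by rewrite lead_coef_map_inj ?rmorph0 // lead_coefXaddC expr1n mulr1.
Qed.

Lemma pshift_inj : injective (pshift s n).
Proof.
move=> p q /eqP; rewrite -subr_eq0 -rmorphB -size_poly_eq0 size_pshift size_poly_eq0.
by rewrite subr_eq0 => /eqP.
Qed.
End PolyShiftDomain.

Section FracShift.
Variables (F : fieldType) (s : {rmorphism F -> F}) (n : int).

Lemma tofrac_pshift_inj : injective (tofrac \o pshift s n).
Proof. by apply: inj_comp; [exact: tofrac_inj | apply: pshift_inj; apply: fmorph_inj]. Qed.

Definition fshift : {rmorphism {fraction {poly F}} -> {fraction {poly F}}} :=
  frac_lift tofrac_pshift_inj.

Lemma fshift_tofrac p : fshift (tofrac p) = tofrac (pshift s n p).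
Proof. exact: frac_lift_tofrac. Qed.

Lemma fshift_div p q : fshift (tofrac p / tofrac q) = tofrac (pshift s n p) / tofrac (pshift s n q).
Proof. by rewrite fmorph_div !fshift_tofrac. Qed.
End FracShift.

Lemma fshift_comp (F : fieldType) (s1 s2 s3 : {rmorphism F -> F}) n1 n2 u :
  (forall x, s1 (s2 x) = s3 x) ->
  fshift s1 n1 (fshift s2 n2 u) = fshift s3 (n1 + n2) u.
Proof.
move=> sE; have [a [b [b0 ->]]] := fraction_numden u.
by rewrite !fshift_div !(pshift_comp _ _ _ sE).
Qed.

Lemma fshift_id (F : fieldType) (s : {rmorphism F -> F}) u :
  (forall x, s x = x) -> fshift s 0 u = u.
Proof.
move=> sE; have [a [b [b0 ->]]] := fraction_numden u.
by rewrite fshift_div !pshift_id.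
Qed.

Section RationalPolyEmbedding.
Variables (R : idomainType) (E : fieldType) (j : {rmorphism R -> E}).
Hypothesis j_inj : injective j.

Definition poly_frac : {rmorphism {poly R} -> {fraction {poly E}}} := tofrac \o map_poly j.

Lemma poly_frac_inj : injective poly_frac.
Proof. by apply: inj_comp; [exact: tofrac_inj | apply: map_inj_poly j_inj (rmorph0 j)]. Qed.

Lemma poly_frac_surj : (forall e : E, exists a b, b != 0 /\ e = j a / j b) ->
  forall u : {fraction {poly E}}, exists a b, b != 0 /\ u = poly_frac a / poly_frac b.
Proof.
move=> j_frac u; have [p [q [q0 ->]]] := fraction_numden u.
have [a [f [a0 fE]]] := clear_denominators j_inj j_frac p.
have [b [g [b0 gE]]] := clear_denominators j_inj j_frac q.
have jp x : x != 0 -> (j x)%:P != 0 :> {poly E} by rewrite polyC_eq0; apply: inj_rmorph_neq0.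
have g0 : g != 0.
  apply: contraTneq (mulf_neq0 (jp b b0) q0) => g0.
  by rewrite gE g0 rmorph0 eqxx.
exists (b%:P * f), (a%:P * g); split; first by rewrite mulf_neq0 ?polyC_eq0.
apply/eqP; rewrite eqr_div; last 2 first.
- exact: tofrac_neq0.
- by apply: (inj_rmorph_neq0 poly_frac_inj); rewrite mulf_neq0 ?polyC_eq0.
apply/eqP; rewrite -!(rmorphM tofrac); congr (tofrac _).
rewrite !rmorphM /= !map_polyC /= -fE -gE.
by ring.
Qed.

Lemma poly_frac_shift (s : {rmorphism R -> R}) (s' : {rmorphism E -> E}) n p :
  (forall x, j (s x) = s' (j x)) -> poly_frac (pshift s n p) = fshift s' n (poly_frac p).
Proof. by move=> jE; rewrite /poly_frac /= (pshift_map (s' := s')) ?fshift_tofrac. Qed.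

Lemma poly_fracC x : poly_frac x%:P = tofrac (j x)%:P.
Proof. by rewrite /poly_frac /= map_polyC. Qed.
End RationalPolyEmbedding.

(** * Bigraded projections *)

Section CoefficientwiseMap.
Variables (R : comNzRingType).

(** The maps [g] in view are partial fraction projections, not ring morphisms. Linearity over the
    integers is enough, because a shift of the variable only multiplies coefficients by integers;
    this makes projecting in y compatible with shifting in z. *)
Lemma map_poly_XaddC (g : R -> R) (p : {poly R}) (n : int) (c : R) :
    (forall x y, g (x + y) = g x + g y) -> (forall x m, g (x * m%:~R) = g x * m%:~R) ->
  map_poly g (p * ('X + n%:~R%:P) + c%:P) = map_poly g p * ('X + n%:~R%:P) + (g c)%:P.
Proof.
move=> gD gM; have g0 : g 0 = 0 by have := gM 0 0; rewrite mulr0 => ->; rewrite mulr0.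
apply/polyP => i; rewrite !(coef_map_id0 _ _ g0, coefD, mulrDr, coefMX, coefMC, coefC) !gD gM.
by case: i => [|i] /=; rewrite g0.
Qed.

Lemma map_poly_pshift (g g' : R -> R) (s : {rmorphism R -> R}) n p :
    (forall x y, g (x + y) = g x + g y) -> (forall x m, g (x * m%:~R) = g x * m%:~R) ->
    (forall x y, g' (x + y) = g' x + g' y) -> (forall x m, g' (x * m%:~R) = g' x * m%:~R) ->
    (forall x, g' (s x) = s (g x)) ->
  map_poly g' (pshift s n p) = pshift s n (map_poly g p).
Proof.
move=> gD gM gD' gM' gg; elim/poly_ind: p => [|p c IH].
  have h (f : R -> R) : map_poly f 0 = 0 by apply: map_poly0.
  by rewrite rmorph0 !h rmorph0.
have := map_poly_XaddC p 0 c gD gM; rewrite addr0 => ->.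
rewrite !(rmorphD, rmorphM) /= !pshiftX !pshiftC map_poly_XaddC // gg IH.
by [].
Qed.
End CoefficientwiseMap.

Section Part.
Variable F : fieldType.
Implicit Types (c : {poly F}) (x y : {fraction {poly F}}).

Definition part c l x : {fraction {poly F}} := tofrac (dig c l x) / tofrac c ^+ l.+1.

Lemma part_lin c l a x y : irreducible_poly c ->
  part c l (tofrac a%:P * x + y) = tofrac a%:P * part c l x + part c l y.
Proof. by move=> cI; rewrite /part dig_lin // rmorphD rmorphM /= mulrDl mulrA. Qed.

Lemma partD c l x y : irreducible_poly c -> part c l (x + y) = part c l x + part c l y.
Proof. by move=> cI; have := part_lin l 1 x y cI; rewrite !rmorph1 !mul1r. Qed.

Lemma part0 c l : irreducible_poly c -> part c l 0 = 0.
Proof. by move=> cI; rewrite /part dig0 // rmorph0 mul0r. Qed.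

Lemma partZ c l a x : irreducible_poly c ->
  part c l (tofrac a%:P * x) = tofrac a%:P * part c l x.
Proof. by move=> cI; rewrite -[_ * x]addr0 part_lin // part0 // addr0. Qed.

Lemma part_int c l x (m : int) : irreducible_poly c ->
  part c l (x * m%:~R) = part c l x * m%:~R.
Proof.
by move=> cI; rewrite -[m%:~R](rmorph_int tofrac) -(rmorph_int polyC) mulrC partZ // mulrC.
Qed.

Lemma part_map c l x (s : {rmorphism F -> F}) n : irreducible_poly c ->
    irreducible_poly (pshift s n c) ->
  part (pshift s n c) l (fshift s n x) = fshift s n (part c l x).
Proof.
move=> cI sI; rewrite /part (dig_map (s := pshift s n)) //.
- by rewrite fmorph_div rmorphXn !fshift_tofrac.
- by apply: size_pshift; apply: fmorph_inj.
- exact: fshift_tofrac.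
Qed.

Lemma part_proper c l k (b : {poly F}) : irreducible_poly c -> (size b < size c)%N ->
  part c l (tofrac b / tofrac c ^+ k.+1) = if l == k then tofrac b / tofrac c ^+ k.+1 else 0.
Proof.
move=> cI sb; rewrite /part dig_proper //.
by case: eqP => [->//|_]; rewrite rmorph0 mul0r.
Qed.

Lemma part_coprime c l (a q : {poly F}) : irreducible_poly c -> coprimep q c ->
  part c l (tofrac a / tofrac q) = 0.
Proof. by move=> cI cq; rewrite /part dig_coprime // rmorph0 mul0r. Qed.
End Part.

(** Dividing [b] by one member lowers its degree, and by coprimality every other member dividing [b]
    still divides the quotient. *)
Lemma finite_divisors (F : fieldType) (T : eqType) (good : T -> Prop) (q : T -> {poly F}) :
    (forall t, good t -> irreducible_poly (q t)) ->
    (forall t t', good t -> good t' -> t <> t' -> coprimep (q t) (q t')) ->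
  forall b, b != 0 -> exists s : seq T, forall t, good t -> q t %| b -> t \in s.
Proof.
move=> qI qC b; have [n] := ubnP (size b); elim: n b => // n IH b; rewrite ltnS => sb b0.
have [[t [gt /dvdpP[b' bE]]]|N] := pselect (exists t, good t /\ q t %| b); last first.
  by exists [::] => t gt tb; case: N; exists t.
have b'0 : b' != 0 by apply: contraNneq b0 => b'0; rewrite bE b'0 mul0r.
have q0 : q t != 0 by apply: contraNneq b0 => q0; rewrite bE q0 mulr0.
have [|//|s sP] := IH b'.
  apply: leq_trans sb; rewrite bE size_mul //; move: (qI t gt).1 b'0; rewrite -size_poly_gt0.
  case: (size (q t)) => [|[|i]] // _; case: (size b') => // m _.
  by rewrite addnS /= addSn ltnS addnS ltnS leq_addr.
exists (t :: s) => t' gt' t'b; rewrite inE.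
have [//|/eqP neq /=] := eqVneq t' t; apply: sP => //.
by move: t'b; rewrite bE Gauss_dvdpl //; apply: qC.
Qed.

(** Serves to move a power of c, a scalar with respect to z, from the denominator into the
    coefficients of the numerator. *)
Lemma div_scaled (L : fieldType) (x : L) (p : {poly L}) (y : {fraction {poly L}}) : x != 0 ->
  tofrac p / (tofrac x%:P * y) = tofrac ((x^-1)%:P * p) / y.
Proof.
move=> x0; have x0' : tofrac x%:P != 0 by rewrite tofrac_neq0 ?polyC_eq0.
rewrite invfM mulrA; congr (_ / _); apply: (mulIf x0').
rewrite divfK // -rmorphM; congr (tofrac _).
by rewrite mulrAC -polyCM mulVf // mul1r.
Qed.

Section Projection.
Variable F : fieldType.
Local Notation E := {fraction {poly F}}.
Implicit Types (c : {poly F}) (d : {poly E}) (v : {fraction {poly E}}).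

(* The exponents of [d] and [c] are [k.+1] and [l.+1]; [d] is not made monic, since its leading
   coefficient lies in E and dividing by it would change the denominators in y. *)
Definition proj d c k l v : {fraction {poly E}} :=
  tofrac (map_poly (part c l) (dig d k v)) / tofrac d ^+ k.+1.

Lemma proj_lin d c k l (a : F) u v : irreducible_poly d -> irreducible_poly c ->
  proj d c k l (tofrac (tofrac a%:P)%:P * u + v)
  = tofrac (tofrac a%:P)%:P * proj d c k l u + proj d c k l v.
Proof.
move=> dI cI; rewrite /proj dig_lin // mulrA -mulrDl; congr (_ / _).
rewrite -rmorphM -rmorphD; congr (tofrac _).
apply/polyP => i; have p0 := part0 l cI.
by rewrite !(coef_map_id0 _ _ p0, coefD, coefCM) part_lin.
Qed.

Lemma proj_map d c d' c' k l v (s : {rmorphism F -> F}) n m :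
    d' = pshift (fshift s n) m d -> c' = pshift s n c ->
    irreducible_poly d -> irreducible_poly c -> irreducible_poly d' -> irreducible_poly c' ->
  proj d' c' k l (fshift (fshift s n) m v) = fshift (fshift s n) m (proj d c k l v).
Proof.
move=> -> -> dI cI sdI scI; rewrite /proj (dig_map (s := pshift (fshift s n) m)) //.
- rewrite fmorph_div rmorphXn !fshift_tofrac; congr (tofrac _ / _).
  apply: map_poly_pshift => *; rewrite ?partD ?part_int ?part_map //.
- by apply: size_pshift; apply: fmorph_inj.
- exact: fshift_tofrac.
Qed.

Lemma proj_coprime d c k l a q : irreducible_poly d -> coprimep q d ->
  proj d c k l (tofrac a / tofrac q) = 0.
Proof.
by move=> dI cq; rewrite /proj dig_coprime // map_poly0 rmorph0 mul0r.
Qed.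

Lemma proj_proper d c k l (a : {poly E}) : irreducible_poly d -> (size a < size d)%N ->
  proj d c k l (tofrac a / tofrac d ^+ k.+1) = tofrac (map_poly (part c l) a) / tofrac d ^+ k.+1.
Proof. by move=> dI sa; rewrite /proj dig_proper // eqxx. Qed.

Section Term.
Variables (d : {poly E}) (c : {poly F}) (k l : nat) (a : {poly E}) (b : nat -> {poly F}).
Hypotheses (dI : irreducible_poly d) (cI : irreducible_poly c) (sa : (size a < size d)%N).
Hypothesis aE : forall i, a`_i = tofrac (b i) / tofrac c ^+ l.+1.
Hypothesis sb : forall i, (size (b i) < size c)%N.

Lemma proj_term l' : proj d c k l' (tofrac a / tofrac d ^+ k.+1)
  = if l' == l then tofrac a / tofrac d ^+ k.+1 else 0.
Proof.
have aE' : map_poly (part c l') a = if l' == l then a else 0.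
  apply/polyP => i; rewrite (coef_map_id0 _ _ (part0 l' cI)) {1}aE part_proper //.
  by case: eqP; rewrite ?coef0 ?aE.
by rewrite proj_proper // aE'; case: eqP => // _; rewrite rmorph0 mul0r.
Qed.

Lemma proj_term_coprime c' l' : irreducible_poly c' -> coprimep c c' ->
  proj d c' k l' (tofrac a / tofrac d ^+ k.+1) = 0.
Proof.
move=> cI' cc'; have aE' : map_poly (part c' l') a = 0.
  apply/polyP => i; rewrite (coef_map_id0 _ _ (part0 l' cI')) aE -rmorphXn coef0.
  by rewrite part_coprime // coprimep_expl.
by rewrite proj_proper // aE' rmorph0 mul0r.
Qed.
End Term.

Section Support.
Variables (T U : eqType) (goodT : T -> Prop) (goodU : U -> Prop).
Variables (q : T -> {poly E}) (r : U -> {poly F}).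
Hypothesis qI : forall t, goodT t -> irreducible_poly (q t).
Hypothesis rI : forall t, goodU t -> irreducible_poly (r t).
Hypothesis q_coprime : forall t t', goodT t -> goodT t' -> t <> t' -> coprimep (q t) (q t').
Hypothesis r_coprime : forall t t', goodU t -> goodU t' -> t <> t' -> coprimep (r t) (r t').

Lemma part_support l (w : seq E) : exists s : seq U, forall u x, goodU u -> x \in w ->
  part (r u) l x != 0 -> u \in s.
Proof.
elim: w => [|x w [s sP]]; first by exists [::].
have [a [b [b0 xE]]] := fraction_numden x.
have [s' s'P] := finite_divisors rI r_coprime b0.
exists (s' ++ s) => u y gu; rewrite inE mem_cat => /predU1P[->|yw nz]; last first.
  by rewrite (sP u y gu yw nz) orbT.
move=> nz; rewrite s'P //; apply: contraNT nz => nd.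
by rewrite xE part_coprime ?irreducible_coprime ?eqxx //; apply: rI.
Qed.

(** Only the finitely many [q t] dividing the denominator in z matter. For each, the digit has
    finitely many coefficients, each with finitely many [r u] dividing its denominator in y. *)
Lemma proj_support k l v : exists s : seq (T * U), forall t u, goodT t -> goodU u ->
  proj (q t) (r u) k l v != 0 -> (t, u) \in s.
Proof.
have [a [b [b0 vE]]] := fraction_numden v.
have [sT sTP] := finite_divisors qI q_coprime b0.
have [s sP] : exists s : seq (T * U), forall t u, t \in sT -> goodU u ->
    proj (q t) (r u) k l v != 0 -> (t, u) \in s.
  elim: sT {sTP} => [|t sT [s sP]]; first by exists [::].
  have [s' s'P] := part_support l (dig (q t) k v).
  exists ([seq (t, u) | u <- s'] ++ s) => t' u.
  rewrite inE mem_cat => /predU1P[->|t'T] gu nz; last by rewrite (sP t' u) ?orbT.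
  apply/orP; left; apply: map_f; apply: contraNT nz => nu.
  suff E0 : map_poly (part (r u) l) (dig (q t) k v) = 0 by rewrite /proj E0 rmorph0 mul0r.
  apply/polyP => i; have p0 := part0 l (rI gu); rewrite (coef_map_id0 _ _ p0) coef0.
  have [lti|lei] := ltnP i (size (dig (q t) k v)); last by rewrite nth_default.
  apply/eqP; apply: contraNT nu; apply: s'P => //; exact: mem_nth.
exists s => t u gt gu nz; apply: sP => //; apply: sTP => //; apply: contraNT nz => nd.
by rewrite vE proj_coprime ?irreducible_coprime ?eqxx //; apply: qI.
Qed.
End Support.
End Projection.

(** * The tower K(x)(y)(z) *)

Lemma irreducible_elt_iso (R : idomainType) (f g : {rmorphism R -> R}) p :
  cancel f g -> cancel g f -> irreducible_elt p -> irreducible_elt (f p).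
Proof.
move=> fK gK [p0 [pN pI]]; split; first by rewrite -(rmorph0 f) (can_eq fK).
have fU x : f x \is a GRing.unit -> x \is a GRing.unit.
  by move=> /(rmorph_unit g); rewrite fK.
split; first by apply: contra pN; apply: fU.
move=> a b E; have : p = g a * g b by rewrite -rmorphM -E fK.
by move=> /pI[/(rmorph_unit f)|/(rmorph_unit f)]; rewrite gK; [left|right].
Qed.

Lemma irreducible_elt_mul_unit (R : idomainType) (u p : R) :
  u \is a GRing.unit -> irreducible_elt p -> irreducible_elt (u * p).
Proof.
move=> uU [p0 [pN pI]]; split.
  by rewrite mulf_neq0 //; apply: contraTneq uU => ->; rewrite unitr0.
split; first by rewrite unitrM uU.
move=> a b E; have : p = (u^-1 * a) * b by rewrite -mulrA -E mulKr.
by move=> /pI[]; [rewrite unitrM unitrV uU; left|right].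
Qed.

Section FixedByShift.
Variable R : idomainType.
Hypothesis natr0 : forall n, ((n%:R : R) == 0) = (n == 0%N).

Lemma poly_natr0 n : ((n%:R : {poly R}) == 0) = (n == 0%N).
Proof. by rewrite -polyC_natr polyC_eq0. Qed.

Lemma intr_neq0 (m : int) : m != 0 -> (m%:~R : R) != 0.
Proof. by case: m => n nz; rewrite ?NegzE ?mulrNz ?oppr_eq0 -pmulrn natr0. Qed.

(** A fixed [p] takes the same value at 0, n, 2n, and so on. For nonzero n these points are distinct
    in characteristic zero, so [p - p.[0]%:P] would have more roots than its degree. *)
Lemma shift1_fixed n (p : {poly R}) : (1 < size p)%N -> shift1 n p = p -> n = 0.
Proof.
move=> sp fix_p; apply/eqP; apply: contraTT isT => n0.
have per k : p.[(n *+ k)%:~R] = p.[0].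
  elim: k => [|k IH]; first by rewrite mulr0n.
  by rewrite -IH -[in RHS]fix_p /shift1 horner_comp !hornerE mulrSr intrD.
pose q := p - p.[0]%:P.
have sq : size q = size p.
  by rewrite size_polyDl // size_polyN (leq_ltn_trans (size_polyC_leq1 _)).
have q0 : q != 0 by rewrite -size_poly_gt0 sq ltnW.
pose rs := [seq ((n *+ k)%:~R : R) | k <- iota 0 (size q)].
have := @max_poly_roots _ q rs q0; rewrite size_map size_iota ltnn; apply.
  by apply/allP => _ /mapP[k _ ->]; rewrite /root !hornerE per subrr.
rewrite map_inj_uniq ?iota_uniq // => i k /eqP; rewrite -subr_eq0 -intrB.
case: (ltngtP i k) => // lt; rewrite (negPf (intr_neq0 _)) //.
  rewrite -opprB oppr_eq0 -mulrnBr 1?ltnW // Num.Theory.mulrn_eq0 negb_or n0 andbT.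
  by rewrite subn_eq0 -ltnNge.
by rewrite -mulrnBr 1?ltnW // Num.Theory.mulrn_eq0 negb_or n0 andbT subn_eq0 -ltnNge.
Qed.
End FixedByShift.

Lemma poly_unit_lead (R : idomainType) (t : {poly R}) : t \is a GRing.unit ->
  t = (lead_coef t)%:P /\ lead_coef t \is a GRing.unit.
Proof.
rewrite poly_unitE => /andP[/eqP st tU].
by rewrite lead_coefE st; split=> //; apply: size1_polyC; rewrite st.
Qed.

(** * Transport from K(x,y,z) to the tower of one-variable fraction fields *)

Section Transfer.
Variables (K : fieldType) (V : fieldType) (act : int * (int * int) -> {rmorphism V -> V}).
Variable phi : {rmorphism Fxyz K -> V}.

Lemma summable_transfer : (forall v, exists u, phi u = v) ->
    (forall u, phi (Fsy 1 u) = act (0, (1, 0)) (phi u)) ->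
    (forall u, phi (Fsz 1 u) = act (0, (0, 1)) (phi u)) ->
  forall g, yz_summable g <-> summable act (phi g).
Proof.
move=> phi_surj Y Z g; split=> [[u [w ->]]|[u [w gE]]].
  by exists (phi u), (phi w); rewrite rmorphD !rmorphB Y Z.
have [u' u'E] := phi_surj u; have [w' w'E] := phi_surj w.
exists u', w'; apply: (fmorph_inj phi).
by rewrite rmorphD !rmorphB Y Z u'E w'E.
Qed.

Lemma apply_op_transfer (eta : Fx K -> V) : (forall a, phi (fracxF a) = eta a) ->
    (forall n u, phi (Fsx n u) = act (n, 0) (phi u)) ->
  forall N (l : 'I_N.+1 -> Fx K) f,
  phi (apply_op l f) = \sum_(i < N.+1) eta (l i) * act (Posz i, 0) (phi f).
Proof.
move=> etaE X N l f; rewrite /apply_op rmorph_sum; apply: eq_bigr => i _.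
by rewrite rmorphM etaE X.
Qed.

Lemma fracmap_transfer (f : Pxyz K -> Pxyz K) g :
    (forall p, phi (tofrac (f p)) = act g (phi (tofrac p))) ->
  forall u, phi (fracmap f u) = act g (phi u).
Proof. by move=> fE u; rewrite [in RHS](fraction_repr u) /fracmap !fmorph_div !fE. Qed.

Lemma fracxF_transfer (eta : {rmorphism Fx K -> V}) :
    (forall p, phi (tofrac p%:P%:P) = eta (tofrac p)) ->
  forall u, phi (fracxF u) = eta u.
Proof. by move=> etaE u; rewrite [in RHS](fraction_repr u) /fracxF !fmorph_div !etaE. Qed.

Lemma term_transfer (j : {rmorphism Pxyz K -> V}) : (forall p, phi (tofrac p) = j p) ->
  forall b c d n, phi (polyF b / (polyxyF c * polyF (d ^+ n))) = j b / (j c%:P * j d ^+ n).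
Proof.
move=> jE b c d n; rewrite /polyF /polyxyF (fmorph_div phi) (rmorphM phi) !jE.
by rewrite (rmorphXn j).
Qed.
End Transfer.

Section Tower.
Variable K : fieldType.
Hypothesis natr0 : forall n, ((n%:R : K) == 0) = (n == 0%N).
Notation grp := (int * (int * int))%type.
Notation Rx := {poly K}.
Notation Rxy := {poly {poly K}}.
Notation Rxyz := {poly {poly {poly K}}}.
Notation F := {fraction {poly K}}.
Notation E := {fraction {poly F}}.
Notation V := {fraction {poly E}}.

Definition jF : {rmorphism Rx -> F} := tofrac.
Definition jE : {rmorphism Rxy -> E} := poly_frac jF.
Definition jV : {rmorphism Rxyz -> V} := poly_frac jE.

Lemma jF_inj : injective jF. Proof. exact: tofrac_inj. Qed.
Lemma jE_inj : injective jE. Proof. exact: poly_frac_inj jF_inj. Qed.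
Lemma jV_inj : injective jV. Proof. exact: poly_frac_inj jE_inj. Qed.

Lemma jF_frac (e : F) : exists a b, b != 0 /\ e = jF a / jF b.
Proof. exact: fraction_numden. Qed.

Lemma jE_frac (e : E) : exists a b, b != 0 /\ e = jE a / jE b.
Proof. exact: (poly_frac_surj jF_inj jF_frac). Qed.

Definition toV : {rmorphism {fraction Rxyz} -> V} := frac_lift jV_inj.

(** Serves to pull summability witnesses found in the tower back to K(x,y,z). *)
Lemma toV_surj v : exists u, toV u = v.
Proof.
have [a [b [b0 ->]]] := poly_frac_surj jE_inj jE_frac v.
by exists (tofrac a / tofrac b); rewrite /toV /= frac_lift_div.
Qed.

Definition s1 (a : int) : {rmorphism Rx -> Rx} := pshift idfun a.
Definition s2 (a b : int) : {rmorphism Rxy -> Rxy} := pshift (s1 a) b.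
Definition s3 (g : grp) : {rmorphism Rxyz -> Rxyz} := pshift (s2 g.1 g.2.1) g.2.2.
Definition aF (a : int) : {rmorphism F -> F} := fshift idfun a.
Definition aE (a b : int) : {rmorphism E -> E} := fshift (aF a) b.
Definition aV (g : grp) : {rmorphism V -> V} := fshift (aE g.1 g.2.1) g.2.2.

Lemma s1_comp a a' p : s1 a (s1 a' p) = s1 (a + a') p.
Proof. exact: pshift_comp. Qed.
Lemma s2_comp a b a' b' p : s2 a b (s2 a' b' p) = s2 (a + a') (b + b') p.
Proof. exact/pshift_comp/s1_comp. Qed.
Lemma s3_comp g g' p : s3 g (s3 g' p) = s3 (g + g') p.
Proof. exact/pshift_comp/s2_comp. Qed.
Lemma aF_comp a a' p : aF a (aF a' p) = aF (a + a') p.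
Proof. exact: fshift_comp. Qed.
Lemma aE_comp a b a' b' p : aE a b (aE a' b' p) = aE (a + a') (b + b') p.
Proof. exact/fshift_comp/aF_comp. Qed.
Lemma aV_comp g g' p : aV g (aV g' p) = aV (g + g') p.
Proof. exact/fshift_comp/aE_comp. Qed.
Lemma s1_0 p : s1 0 p = p. Proof. exact: pshift_id. Qed.
Lemma s2_0 p : s2 0 0 p = p. Proof. exact/pshift_id/s1_0. Qed.
Lemma s3_0 p : s3 0 p = p. Proof. exact/pshift_id/s2_0. Qed.
Lemma aF_0 p : aF 0 p = p. Proof. exact: fshift_id. Qed.
Lemma aE_0 p : aE 0 0 p = p. Proof. exact/fshift_id/aF_0. Qed.
Lemma aV_0 p : aV 0 p = p. Proof. exact/fshift_id/aE_0. Qed.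

Lemma s1_inj a : injective (s1 a). Proof. by apply: pshift_inj. Qed.
Lemma s2_inj a b : injective (s2 a b). Proof. exact/pshift_inj/s1_inj. Qed.

Lemma jE_s2 a b p : jE (s2 a b p) = aE a b (jE p).
Proof. by apply: poly_frac_shift => x; symmetry; apply: fshift_tofrac. Qed.

Lemma jV_s3 g p : jV (s3 g p) = aV g (jV p).
Proof. exact/poly_frac_shift/jE_s2. Qed.

Lemma toV_tofrac p : toV (tofrac p) = jV p.
Proof. exact: frac_lift_tofrac. Qed.

Lemma toV_fracmap (f : Rxyz -> Rxyz) g u : (forall p, f p = s3 g p) ->
  toV (fracmap f u) = aV g (toV u).
Proof. by move=> fE; apply: (fracmap_transfer (g := g)) => p; rewrite fE !toV_tofrac jV_s3. Qed.

Lemma s1E a p : s1 a p = shift1 a p.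
Proof. by rewrite /s1 /= /pshift map_poly_id. Qed.

Lemma sxy_xE a p : sxy_x a p = s2 a 0 p.
Proof.
rewrite /s2 /= /pshift /shift1 addr0 comp_polyXr.
by apply: eq_map_poly => x; rewrite -s1E.
Qed.

Lemma sxy_yE b p : sxy_y b p = s2 0 b p.
Proof.
by rewrite /sxy_y /s2 /= /pshift; congr (shift1 _ _); rewrite map_poly_id // => x _; rewrite s1_0.
Qed.

Lemma sxE a p : sx a p = s3 (a, 0) p.
Proof.
rewrite /s3 /= /pshift /shift1 addr0 comp_polyXr.
by apply: eq_map_poly => x; rewrite -sxy_xE.
Qed.

Lemma syE b p : sy b p = s3 (0, (b, 0)) p.
Proof.
rewrite /s3 /= /pshift /shift1 addr0 comp_polyXr.
by apply: eq_map_poly => x; rewrite -sxy_yE.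
Qed.

Lemma szE c p : sz c p = s3 (0, (0, c)) p.
Proof.
by rewrite /sz /s3 /= /pshift; congr (shift1 _ _); rewrite map_poly_id // => x _; rewrite s2_0.
Qed.

Definition eta : {rmorphism F -> V} := tofrac \o polyC \o tofrac \o polyC.

Lemma aV_eta h a : aV (0, h) (eta a) = eta a.
Proof.
rewrite /aV /eta /= fshift_tofrac pshiftC /aE fshift_tofrac pshiftC.
by rewrite aF_0.
Qed.

Lemma toV_fracxF u : toV (fracxF u) = eta u.
Proof.
by apply: (fracxF_transfer (eta := eta)) => p; rewrite toV_tofrac [LHS]poly_fracC [jE _]poly_fracC.
Qed.

Lemma yz_summableE g : yz_summable g <-> summable aV (toV g).
Proof.
apply: (summable_transfer (phi := toV)); [exact: toV_surj | |] => u.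
  exact/toV_fracmap/syE.
exact/toV_fracmap/szE.
Qed.

Lemma toV_apply_op N (l : 'I_N.+1 -> F) f :
  toV (apply_op l f) = \sum_(i < N.+1) eta (l i) * aV (Posz i, 0) (toV f).
Proof.
apply: apply_op_transfer => [|n u]; first exact: toV_fracxF.
by apply: (toV_fracmap (g := (n, 0))) => p; apply: sxE.
Qed.

Definition lc2 (p : Rxy) : K := lead_coef (lead_coef p).
Definition lc3 (p : Rxyz) : K := lc2 (lead_coef p).

Lemma lc2_s2 a b p : lc2 (s2 a b p) = lc2 p.
Proof.
rewrite /lc2 /s2 /= lead_coef_pshift; last exact: s1_inj.
by rewrite /s1 /= lead_coef_pshift.
Qed.

Lemma lc3_s3 g p : lc3 (s3 g p) = lc3 p.
Proof. by rewrite /lc3 /s3 /= lead_coef_pshift; [exact: lc2_s2 | exact: s2_inj]. Qed.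

Lemma lc2_eq0 p : (lc2 p == 0) = (p == 0).
Proof. by rewrite /lc2 !lead_coef_eq0. Qed.

Lemma lc2_unit t : t \is a GRing.unit -> lc2 t = 1 -> t = 1.
Proof.
move=> /poly_unit_lead[tE /poly_unit_lead[lE _]] l1.
by rewrite tE lE [lead_coef _]l1 !polyC1.
Qed.

Lemma lc3_unit t : t \is a GRing.unit -> lc3 t = 1 -> t = 1.
Proof. by move=> /poly_unit_lead[tE lU] l1; rewrite tE (lc2_unit lU l1) polyC1. Qed.

Lemma factorial_Rx : factorial_domain Rx.
Proof. exact/factorial_poly/factorial_field. Qed.
Lemma factorial_Rxy : factorial_domain Rxy.
Proof. exact/factorial_poly/factorial_Rx. Qed.

(* A fixed leading coefficient makes associated members equal. *)
(* Shifts preserve the iterated leading coefficient; fixing it turns "associated" into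
   "equal", so that distinct good polynomials are coprime. *)
Definition good_d (delta : K) (d : Rxyz) :=
  [/\ irreducible_elt d, (1 < size d)%N & lc3 d = delta].

Definition good_c (c : Rxy) :=
  [/\ irreducible_elt c, (1 < size c)%N, lc2 c = 1
    & forall a b, s2 a b c = c -> a = 0].

Lemma good_d_irreducible delta d : good_d delta d -> irreducible_poly (map_poly jE d).
Proof. by case=> dI sd _; exact (irreducible_poly_frac jE_inj jE_frac factorial_Rxy dI sd). Qed.

Lemma good_c_irreducible c : good_c c -> irreducible_poly (map_poly jF c).
Proof.
case=> cI sc _ _; exact: (irreducible_poly_frac jF_inj jF_frac factorial_Rx cI sc).
Qed.

Lemma good_d_coprime delta d d' : delta != 0 -> good_d delta d -> good_d delta d' -> d <> d' ->
  coprimep (map_poly jE d) (map_poly jE d').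
Proof.
move=> delta0 [dI sd ld] [dI' sd' ld'] neq.
have [//|[t tU d'E]] := coprime_or_associate jE_inj jE_frac factorial_Rxy dI dI' sd sd'.
case: neq; rewrite d'E (lc3_unit tU) ?mulr1 //.
have E0 : delta * lc3 t = delta * 1.
  by rewrite mulr1 -{1}ld -ld' d'E /lc3 /lc2 !lead_coefM.
exact: (mulfI delta0 E0).
Qed.

Lemma good_c_coprime c c' : good_c c -> good_c c' -> c <> c' ->
  coprimep (map_poly jF c) (map_poly jF c').
Proof.
move=> [cI sc lc _] [cI' sc' lc' _] neq.
have [//|[t tU c'E]] :=
  coprime_or_associate jF_inj jF_frac factorial_Rx cI cI' sc sc'.
case: neq; rewrite c'E (lc2_unit tU) ?mulr1 //.
by rewrite -lc' c'E /lc2 !lead_coefM [lead_coef (lead_coef c)]lc mul1r.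
Qed.

Definition tact (g : grp) (e : Rxyz * Rxy) : Rxyz * Rxy := (s3 g e.1, s2 g.1 g.2.1 e.2).
Definition good delta (e : Rxyz * Rxy) := good_d delta e.1 /\ good_c e.2.

Lemma good_d_s3 delta g d : good_d delta d -> good_d delta (s3 g d).
Proof.
case=> dI sd ld; split; last by rewrite (lc3_s3 g d).
  apply: (irreducible_elt_iso (f := s3 g) (g := s3 (- g))) dI => p.
    by rewrite (s3_comp (- g) g p) addNr s3_0.
  by rewrite (s3_comp g (- g) p) subrr s3_0.
by rewrite size_pshift //; apply: s2_inj.
Qed.

Lemma good_c_s2 a b c : good_c c -> good_c (s2 a b c).
Proof.
case=> cI sc lc cN; split; last 2 first.
- by rewrite (lc2_s2 a b c).
- move=> a' b' E; apply: (cN a' b'); apply: (@s2_inj a b).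
  by rewrite -[RHS]E !s2_comp addrC [b + _]addrC.
- apply: (irreducible_elt_iso (f := s2 a b) (g := s2 (- a) (- b))) cI => p.
    by rewrite (s2_comp (- a) (- b) a b p) !addNr s2_0.
  by rewrite (s2_comp a b (- a) (- b) p) !subrr s2_0.
- by rewrite size_pshift //; apply: s1_inj.
Qed.

Lemma good_tact delta g e : good delta e -> good delta (tact g e).
Proof. by case=> gd gc; split; [apply: good_d_s3 | apply: good_c_s2]. Qed.

Lemma tact_comp g g' e : tact g (tact g' e) = tact (g + g') e.
Proof. by rewrite /tact /= s3_comp s2_comp. Qed.

Lemma tact_0 e : tact 0 e = e.
Proof. by case: e => d c; rewrite /tact /= s3_0 s2_0. Qed.

(** Neither entry suffices alone: z-shifts act trivially on [c'], and mixed shifts may fix [d']. The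
    last clause of [good_c] kills the x-part, the positive degree of [c'] in y then kills the
    y-part, and the positive degree of [d'] in z the z-part. *)
Lemma tact_free delta g e : good delta e -> tact g e = e -> g = 0.
Proof.
case: g => a [b c]; case: e => d' c' [[dI sd ld] [cI sc lc cN]] /= [dE cE].
have a0 := cN _ _ cE; rewrite {}a0 in dE cE *.
have b0 : b = 0.
  apply: (shift1_fixed (poly_natr0 natr0)) sc _.
  by rewrite -[shift1 b c']/(sxy_y b c') sxy_yE.
rewrite {}b0 in dE cE *.
suff -> : c = 0 by [].
apply: (shift1_fixed (poly_natr0 (poly_natr0 natr0))) sd _.
by rewrite -[shift1 c d']/(sz c d') szE.
Qed.

Definition pr k l (e : Rxyz * Rxy) (v : V) : V := proj (map_poly jE e.1) (map_poly jF e.2) k l v.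

Lemma pr_lin delta k l e a u v : good delta e ->
  pr k l e (eta a * u + v) = eta a * pr k l e u + pr k l e v.
Proof.
by case=> gd gc; apply: proj_lin; [apply: good_d_irreducible gd | apply: good_c_irreducible].
Qed.

Lemma pr_act delta k l g e v : good delta e -> pr k l (tact g e) (aV g v) = aV g (pr k l e v).
Proof.
move=> ge; have [gd gc] := ge; have [gd' gc'] := good_tact g ge.
have jE1 : map_poly jE (s3 g e.1) = pshift (aE g.1 g.2.1) g.2.2 (map_poly jE e.1).
  by apply: pshift_map; apply: jE_s2.
have jF1 : map_poly jF (s2 g.1 g.2.1 e.2) = pshift (aF g.1) g.2.1 (map_poly jF e.2).
  by apply: pshift_map => x; rewrite /jF /= fshift_tofrac.
exact (proj_map k l v jE1 jF1 (good_d_irreducible gd) (good_c_irreducible gc)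
  (good_d_irreducible gd') (good_c_irreducible gc')).
Qed.

Lemma pr_supp delta k l v : delta != 0 -> exists s : seq (Rxyz * Rxy), forall e,
  good delta e -> pr k l e v != 0 -> e \in s.
Proof.
move=> delta0.
have [s sP] := @proj_support F _ _ (good_d delta) good_c (map_poly jE) (map_poly jF)
  (@good_d_irreducible delta) good_c_irreducible
  (fun d d' => @good_d_coprime delta d d' delta0) good_c_coprime k l v.
by exists s => -[d c] [/= gd gc]; apply: sP.
Qed.
End Tower.

(** * The terms of r as single components *)

Section Term.
Variable K : fieldType.

(** The constant [kappa] separating [c] from its normalised form [c1] moves to the numerator, where
    it does not affect degrees. *)
Lemma coef_term (kappa : K) (c c1 : {poly {poly K}}) n x : kappa != 0 ->
    c = kappa%:P%:P * c1 ->
  (jE K c ^+ n)^-1 * jE K x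
  = tofrac (((jF K kappa%:P ^+ n)^-1)%:P * map_poly (jF K) x) / tofrac (map_poly (jF K) c1) ^+ n.
Proof.
move=> kappa0 ->; rewrite -div_scaled; last first.
  by rewrite expf_neq0 // (inj_rmorph_neq0 (@jF_inj K)) // polyC_eq0.
rewrite mulrC; congr (_ / _).
by rewrite (rmorphM (jE K)) [jE K _%:P]poly_fracC exprMn -!rmorphXn.
Qed.

Variables (delta : K) (d : Pxyz K) (c c1 : Pxy K) (kappa : K).
Hypotheses (delta0 : delta != 0) (gd : good_d delta d) (gc : good_c c1).
Hypotheses (kappa0 : kappa != 0) (cE : c = kappa%:P%:P * c1).
Variable b : Pxyz K.
Hypotheses (sb : (size b < size d)%N) (syb : (sizey b < size c)%N).

Lemma pr_term k l l' e' : good delta e' ->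
  pr k l' e' (toV K (polyF b / (polyxyF (c ^+ l.+1) * polyF (d ^+ k.+1))))
  = if (e' == (d, c1)) && (l' == l)
    then toV K (polyF b / (polyxyF (c ^+ l.+1) * polyF (d ^+ k.+1))) else 0.
Proof.
move=> [gd' gc'].
pose a := ((jE K c ^+ l.+1)^-1)%:P * map_poly (jE K) b.
have c0 : c != 0.
  by rewrite cE mulf_neq0 ?polyC_eq0 //; case: gc => _ s1 _ _; rewrite -size_poly_gt0 ltnW.
have jc0 : jE K c ^+ l.+1 != 0 by rewrite expf_neq0 // (inj_rmorph_neq0 (@jE_inj K)).
have -> : toV K (polyF b / (polyxyF (c ^+ l.+1) * polyF (d ^+ k.+1)))
    = tofrac a / tofrac (map_poly (jE K) d) ^+ k.+1.
  rewrite (term_transfer (@toV_tofrac K)) [jV K _%:P]poly_fracC rmorphXn.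
  exact: div_scaled.
have dI := good_d_irreducible gd; have cI := good_c_irreducible gc.
have sa : (size a < size (map_poly (jE K) d))%N.
  by rewrite size_Cmul ?invr_eq0 // !size_map_j //; apply: jE_inj.
(* These are the numerators of the coefficients of [a] over powers of [c1]. The bound on [sizey b]
   makes each such fraction proper in y, so that [part] reproduces it at its own order. *)
pose beta i := ((jF K kappa%:P ^+ l.+1)^-1)%:P * map_poly (jF K) b`_i.
have aE i : a`_i = tofrac (beta i) / tofrac (map_poly (jF K) c1) ^+ l.+1.
  by rewrite coefCM coef_map (coef_term _ _ kappa0 cE).
have sbeta i : (size (beta i) < size (map_poly (jF K) c1))%N.
  have -> : size (map_poly (jF K) c1) = size c.
    by rewrite (size_map_j (@jF_inj K)) cE size_Cmul ?polyC_eq0.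
  apply: leq_ltn_trans syb; rewrite /beta mul_polyC; apply: leq_trans (size_scale_leq _ _) _.
  rewrite (size_map_j (@jF_inj K)) /sizey.
  have [lti|lei] := ltnP i (size b); last by rewrite nth_default // size_poly0.
  exact: (leq_bigmax (F := fun i : 'I_(size b) => size b`_i) (Ordinal lti)).
case: e' gd' gc' => d' c' /= gd' gc'; rewrite /pr xpair_eqE /=.
have [->|/eqP neqd] := eqVneq d' d; last first.
  rewrite -rmorphXn proj_coprime //; first exact: good_d_irreducible gd'.
  by rewrite coprimep_expl // (good_d_coprime delta0 gd gd') // => E; apply: neqd.
have [->|/eqP neqc] := eqVneq c' c1; first exact: (proj_term _ dI cI sa aE sbeta).
apply: (proj_term_coprime _ dI sa aE); first exact: good_c_irreducible.
by rewrite good_c_coprime // => E; apply: neqc.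
Qed.
End Term.

Section Normalization.
Variables (K : fieldType) (c : Pxy K).
Hypotheses (cI : irreducible_elt c) (sc : (1 < size c)%N).
Hypothesis c_shift : ~ exists n' k' : int, 0 < n' /\ sxy_x n' c = sxy_y k' c.

Lemma lc2_neq0 : lc2 c != 0.
Proof. by rewrite lc2_eq0; case: cI. Qed.

(** The various c_i may have different leading coefficients, while [good_c] asks for a common one,
    here 1. For [d] no scaling takes place: its own [lc3] serves as [delta]. *)
Definition normalized : Pxy K := (lc2 c)^-1%:P%:P * c.

Lemma normalizedE : c = (lc2 c)%:P%:P * normalized.
Proof. by rewrite mulrA -!polyCM mulfV ?lc2_neq0 // !polyC1 mul1r. Qed.

(** The hypothesis speaks of positive x-shifts; for negative [a] the inverse shift fixes [c] as
    well. *)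
Lemma s2_fixed_free a b : s2 K a b c = c -> a = 0.
Proof.
have key a' b' : s2 K a' b' c = c -> ~ 0 < a'.
  move=> E pos; apply: c_shift; exists a', (- b'); split=> //.
  by rewrite sxy_xE sxy_yE -{2}E s2_comp add0r addNr.
move=> E; case: (Num.Theory.ltrgt0P a) => //; first by move/(key _ _ E).
rewrite -Num.Theory.oppr_gt0 => /(key (- a) (- b))[].
by rewrite -{1}E s2_comp !addNr s2_0.
Qed.

Lemma good_normalized : good_c normalized.
Proof.
have inv0 : (lc2 c)^-1 != 0 by rewrite invr_eq0 lc2_neq0.
have C0 : (lc2 c)^-1%:P%:P != 0 :> Pxy K by rewrite !polyC_eq0.
split.
- apply: irreducible_elt_mul_unit => //.
  by apply: (rmorph_unit polyC); apply: (rmorph_unit polyC); rewrite unitfE.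
- by rewrite size_Cmul // polyC_eq0.
- by rewrite /lc2 !lead_coefM !lead_coefC mulVf // lc2_neq0.
- move=> a b; rewrite /normalized (rmorphM (s2 K a b)).
  have -> : s2 K a b (lc2 c)^-1%:P%:P = (lc2 c)^-1%:P%:P.
    by rewrite [LHS]pshiftC [s1 K a _]pshiftC.
  by move=> /(mulfI C0); apply: s2_fixed_free.
Qed.
End Normalization.

Section NormalForm.
Variables (K : fieldType) (natr0 : forall n, ((n%:R : K) == 0) = (n == 0%N)).
Variables (k : nat) (d : Pxyz K) (d_irr : irreducible_elt d).
Variables (I : nat) (mi : 'I_I -> nat) (b : 'I_I -> nat -> Pxyz K) (c : 'I_I -> Pxy K).
Hypothesis hbz : forall i l, (1 <= l <= mi i)%N -> (size (b i l) < size d)%N.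
Hypothesis hc_irr : forall i, irreducible_elt (c i).
Hypothesis hby : forall i l, (1 <= l <= mi i)%N -> (sizey (b i l) < size (c i))%N.
Hypothesis hc_shift : forall i, ~ exists (n' k' : int),
  0 < n' /\ sxy_x n' (c i) = sxy_y k' (c i).

Let term i l := polyF (b i l) / (polyxyF (c i ^+ l) * polyF (d ^+ k.+1)).
Let delta := lc3 d.
Let e i := (d, normalized (c i)).

Let delta0 : delta != 0.
Proof. by rewrite /delta /lc3 lc2_eq0 lead_coef_eq0; case: d_irr. Qed.

Lemma term_concentrated i l : (1 <= l <= mi i)%N ->
  toV K (term i l) = 0 \/ good delta (e i) /\
  forall l' e', good delta e' -> pr k l' e' (toV K (term i l))
    = if (e' == e i) && (l'.+1 == l) then toV K (term i l) else 0.
Proof.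
move=> lm; have sb := hbz lm; have syb := hby lm.
have [b0|b0] := eqVneq (b i l) 0.
  by left; rewrite /term b0 /polyF rmorph0 mul0r rmorph0.
(* A nonzero numerator and the strict degree bounds force positive degree of [d] in z and of [c i]
   in y. *)
right; have sd : (1 < size d)%N.
  by apply: leq_ltn_trans sb; rewrite size_poly_gt0.
have sc : (1 < size (c i))%N.
  apply: leq_ltn_trans syb; have sb0 : (0 < size (b i l))%N by rewrite size_poly_gt0.
  have lt : ((size (b i l)).-1 < size (b i l))%N by rewrite prednK.
  rewrite /sizey; apply: leq_trans (leq_bigmax (F := fun j : 'I__ => size (b i l)`_j) (Ordinal lt)).
  by rewrite size_poly_gt0 -lead_coefE lead_coef_eq0.
have gd : good_d delta d by split.
have gc := good_normalized (hc_irr i) sc (@hc_shift i).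
split=> [//|l' e' ge']; case: l lm sb syb {b0} => [//|l] lm sb syb.
exact: (pr_term delta0 gd gc (lc2_neq0 (hc_irr i)) (normalizedE (hc_irr i)) sb syb).
Qed.

Lemma telescoper_iff_summable :
  let r := \sum_(i < I) \sum_(1 <= l < (mi i).+1) term i l in
  let rl l := \sum_(i < I | (l <= mi i)%N) term i l in
  has_telescoper r <-> (forall l : nat, (1 <= l)%N -> yz_summable (rl l)).
Proof.
move=> r rl.
have dec := telescoper_decoupling (aV_comp (K := K)) (aV_0 (K := K)) (tact_comp (K := K))
  (tact_0 (K := K)) (aV_eta (K := K)) (@good_tact K delta) (@tact_free K natr0 delta)
  (fun l => @pr_lin K delta k l) (fun l => @pr_act K delta k l)
  (fun l v => @pr_supp K delta k l v delta0) term_concentrated.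
have rlE l : toV K (rl l) = \sum_(i | (l <= mi i)%N) toV K (term i l).
  exact: rmorph_sum.
have rE : toV K r = \sum_i \sum_(1 <= l < (mi i).+1) toV K (term i l).
  by rewrite rmorph_sum; apply: eq_bigr => i _; exact: rmorph_sum.
split=> [[N [l [lnz S]]] l' l'1|S].
  apply/yz_summableE; rewrite rlE; apply: (dec.1 _ l' l'1).
  exists N, l; split=> //; rewrite -rE -toV_apply_op.
  exact/yz_summableE.
have [l l1|N [l [lnz S']]] := dec.2 _; first by rewrite -rlE; apply/yz_summableE/S.
exists N, l; split=> //; apply/yz_summableE; rewrite toV_apply_op rE.
exact: S'.
Qed.
End NormalForm.

Theorem theorem6p6
  (K : fieldType) (charK0 : [pchar K] =i pred0)
  (lambda : nat) (lambda_gt0 : (0 < lambda)%N)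
  (d : Pxyz K) (d_irr : irreducible_elt d)
  (ha : exists (m : nat) (n k : int), (0 < m)%N /\ sx (Posz m) d = sy n (sz k d))
  (hb : exists (n1 k1 : int), 0 < n1 /\ sy n1 d = sz k1 d)
  (I : nat) (mi : 'I_I -> nat) (b : 'I_I -> nat -> Pxyz K) (c : 'I_I -> Pxy K)
  (hbz : forall i l, (1 <= l <= mi i)%N -> (size (b i l) < size d)%N)
  (hc_inj : injective c)
  (hc_irr : forall i, irreducible_elt (c i))
  (hby : forall i l, (1 <= l <= mi i)%N -> (sizey (b i l) < size (c i))%N)
  (hc_shift : forall i, ~ exists (n' k' : int),
       0 < n' /\ sxy_x n' (c i) = sxy_y k' (c i)) :
  let r : Fxyz K :=
    \sum_(i < I) \sum_(1 <= l < (mi i).+1)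
       polyF (b i l) / (polyxyF (c i ^+ l) * polyF (d ^+ lambda)) in
  let rl (l : nat) : Fxyz K :=
    \sum_(i < I | (l <= mi i)%N)
       polyF (b i l) / (polyxyF (c i ^+ l) * polyF (d ^+ lambda)) in
  has_telescoper r <-> (forall l : nat, (1 <= l)%N -> yz_summable (rl l)).
Proof.
have natr0 n : ((n%:R : K) == 0) = (n == 0%N) by move/pcharf0P: charK0 => ->.
(* [pr k] handles the exponent k + 1 of [d], hence lambda is written as k + 1. *)
case: lambda lambda_gt0 => [//|k] _.
exact: (telescoper_iff_summable natr0 k d_irr hbz hc_irr hby hc_shift).
Qed.
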